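(* Let $\mathcal A=\{A_1,\dots,A_m\}$ be an irreducible finite family of (entrywise) non-negative $d\times d$ matrices that has a unique dominant product with a unique and simple leading eigenvalue. Then $\mathcal A$ possesses a unique invariant body and a unique Barabanov norm (each up to multiplication by a positive constant).
   Context: $\mathcal A$ is irreducible if the matrices $A_i$ share no common invariant linear subspace other than $\{0\}$ and $\mathbb R^d$. $\mathcal A^n$ is the set of all products of $n$ matrices from $\mathcal A$ (repetitions permitted), $\mathcal A^{\mathbb N}=\bigcup_{n\ge1}\mathcal A^n$; products are regarded as words, $|\Pi|$ is the length of $\Pi$. $\rho(S)$ is the spectral radius of a matrix; $\rho(\mathcal A)=\lim_{n\to\infty}\max_{\Pi\in\mathcal A^n}\|\Pi\|^{1/n}$ is the joint spectral radius; $\nu(\Pi)=\rho(\Pi)^{1/|\Pi|}$. A convex body is a convex compact set in $\mathbb R^d$ with nonempty interior, assumed symmetric about the origin. A convex body $G$ is invariant for $\mathcal A$ if $\mathrm{co}\bigl(\bigcup_iA_iG\bigr)=\rho(\mathcal A)\,G$. A Barabanov norm of $\mathcal A$ is a norm $f$ on $\mathbb R^d$ with $\max_if(A_ix)=\rho(\mathcal A)f(x)$ for every $x\in\mathbb R^d$. A product is primitive if it is not a power of a shorter product. A set $\mathcal P\subset\mathcal A^{\mathbb N}$ is a set of dominant products if: (1) all its elements are primitive and none is a cyclic permutation of another; (2) there is $q$ with $\nu(\Pi)=q$ for all $\Pi\in\mathcal P$; (3) there is $\varepsilon>0$ such that every $S\in\mathcal A^{\mathbb N}$ satisfies $\nu(S)\le(1-\varepsilon)^{1/|S|}q$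 unless $S$ is a power of some product from $\mathcal P$ or of one of its cyclic permutations. $\mathcal A$ has a unique dominant product $\Pi$ if $\mathcal P=\{\Pi\}$ is a set of dominant products. A leading eigenvalue is an eigenvalue of largest modulus; it is unique and simple if it is not multiple and all other eigenvalues (except for its complex conjugate if it is non-real) are strictly smaller in modulus. *)

(* Defs.v *)
(* MathComp / MathComp-Analysis; R^d is the space of column vectors 'cV[R]_d
   over an arbitrary R : realType. *)
From mathcomp Require Import all_boot all_order all_algebra.
From mathcomp Require Import complex.
From mathcomp Require Import all_classical all_reals all_analysis.

Set Implicit Arguments.
Unset Strict Implicit.
Unset Printing Implicit Defensive.

Import Order.TTheory GRing.Theory Num.Theory.
Import numFieldNormedType.Exports.

Local Open Scope classical_set_scope.
Local Open Scope ring_scope.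

Section SpectralData.
Context {R : realType} {d : nat}.
Implicit Types (S : 'M[R]_d) (z : R[i]).

Definition complexify S : 'M[R[i]]_d := map_mx (real_complex R) S.

Definition modulus z : R := Normc.normc z.

(* The set is finite, and nonempty when 0 < d, so the sup is a maximum. *)
Definition spectral_radius S : R :=
  sup [set modulus z | z in [set z | eigenvalue (complexify S) z]].

Definition leading_eigenvalue S z : Prop :=
  eigenvalue (complexify S) z /\
  forall y, eigenvalue (complexify S) y -> modulus y <= modulus z.

(* [mup] is the algebraic multiplicity; if z is real then conjc z = z, so the
   last exclusion only matters for non-real z. *)
Definition has_unique_simple_leading_eigenvalue S : Prop :=
  exists z, [/\ leading_eigenvalue S z,
    mup z (char_poly (complexify S)) = 1%N &
    forall y, eigenvalue (complexify S) y ->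
      y != z -> y != conjc z -> modulus y < modulus z].

End SpectralData.

Section Words.
Context {T : eqType}.
Implicit Types w u : seq T.

Definition word_power u k : seq T := flatten (nseq k u).

Definition primitive w : Prop :=
  ~ exists u k, (size u < size w)%N /\ w = word_power u k.

Definition cyclic_perm w u : Prop := exists k, u = rot k w.

End Words.

Section Families.
Context {R : realType} {d m : nat}.
Implicit Types (A : 'I_m -> 'M[R]_d) (w : seq 'M[R]_d).

Definition irreducible_family A : Prop :=
  forall U : {vspace 'cV[R]_d},
    (forall i (x : 'cV[R]_d), x \in U -> A i *m x \in U) ->
    U = 0%VS \/ U = fullv.

(* Products are words whose letters are matrices: possible repetitions among
   the A i do not create new words. *)
Definition product_word A w : Prop := w <> [::] /\ {subset w <= codom A}.

Definition word_prod w : 'M[R]_d := foldr mulmx 1%:M w.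

(* The matrix norm is the max-entry norm; the limit does not depend on the
   choice of the norm. *)
Definition joint_spectral_radius A : R :=
  limn (fun n : nat =>
    \big[Num.max/0]_(s : n.-tuple 'I_m)
      `|word_prod [seq A i | i <- s]| `^ n%:R^-1).

Definition nu w : R := spectral_radius (word_prod w) `^ (size w)%:R^-1.

(* The bound eps < 1 is harmless (eps can always be decreased) and is needed
   because powR is not meaningful on a negative base. *)
Definition dominant_products A (P : set (seq 'M[R]_d)) : Prop :=
  [/\ (forall w, P w -> product_word A w),
      (forall w, P w -> primitive w),
      (forall w u, P w -> P u -> cyclic_perm w u -> w = u) &
      exists q : R, (forall w, P w -> nu w = q) /\
        exists eps : R, 0 < eps < 1 /\
          forall s, product_word A s ->
            ~ (exists w u k, [/\ P w, cyclic_perm w u & s = word_power u k]) ->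
            nu s <= (1 - eps) `^ (size s)%:R^-1 * q].

Definition unique_dominant_product A w : Prop := dominant_products A [set w].

Definition convex_hull (X : set 'cV[R]_d) : set 'cV[R]_d :=
  smallest (@convex_set R 'cV[R]_d) X.

Definition convex_body (G : set 'cV[R]_d) : Prop :=
  [/\ @convex_set R 'cV[R]_d G, compact G, interior G !=set0 &
      forall x, G x -> G (- x)].

Definition scale_set (c : R) (G : set 'cV[R]_d) : set 'cV[R]_d :=
  [set c *: x | x in G].

Definition invariant_body A (G : set 'cV[R]_d) : Prop :=
  convex_body G /\
  convex_hull (\bigcup_i [set A i *m x | x in G]) =
    scale_set (joint_spectral_radius A) G.

Definition is_norm (f : 'cV[R]_d -> R) : Prop :=
  [/\ forall x y, f (x + y) <= f x + f y,
      forall (a : R) x, f (a *: x) = `|a| * f x &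
      forall x, f x = 0 -> x = 0].

Definition barabanov_norm A (f : 'cV[R]_d -> R) : Prop :=
  is_norm f /\
  forall x, \big[Num.max/0]_(i < m) f (A i *m x) =
            joint_spectral_radius A * f x.

End Families.

(* Main.v *)
(* Rescale so that the common value of [nu] is 1, and let [u], [v] be the left
   and right leading eigenvectors of the dominant product, [u v = 1].
   Irreducibility and nonnegativity bound all products: if the [(j, k)] entry
   of a product [T] is positive, then [S k j * T j k] is at most the diagonal
   entry [(S T) k k], hence at most the spectral radius of [S T].  Therefore
   the joint spectral radius is 1 and [F x = sup_S |u S x|] is a Barabanov norm.
   Conversely, if [f] is a Barabanov norm, follow a trajectory of [x] along
   which [f] is constant.  Near a cluster point [y] it recurs, so long products
   [R] along it satisfy [R y ~ y]; since [|det (1 - R)|] is bounded below when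
   [R] has spectral radius at most [1 - eps], such an [R] is a power of a
   cyclic permutation of the dominant product.  As the powers of the dominant
   product converge to [v u], this gives [f x = f v * F x].  The statement on
   invariant bodies is dual: their support functions are the Barabanov norms of
   the transposed family. *)
Require Import Defs.
From mathcomp Require Import all_boot all_order all_algebra.
From mathcomp Require Import perm complex.
From mathcomp Require Import all_classical all_reals all_analysis.
From mathcomp Require Import ring lra zify.

Set Implicit Arguments.
Unset Strict Implicit.
Unset Printing Implicit Defensive.

Import Order.TTheory GRing.Theory Num.Theory.
Import numFieldNormedType.Exports.

Local Open Scope classical_set_scope.
Local Open Scope ring_scope.

(** * Moduli, vanishing sequences and powers of matrices *)

(** Dominance bounds spectral radii only, whereas the recurrence [R y ~ y] concerns vectors and
    infinitely many products [R]. The determinant bound becomes usable because all products share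
    one norm bound: the adjugate of [1 - R] is then bounded too, and [|y| <= K |R y - y|] holds with
    a single [K]. Nonnegativity acts a second time when it forces the leading eigenvalue of the
    rescaled dominant product to be [1] itself; another unimodular eigenvalue would let the powers
    rotate instead of converging. Simplicity of that eigenvalue makes [u v] nonzero. Irreducibility
    enters as the nonvanishing of some coefficient [y S v], a form that survives transposition, so
    the dual statement reuses the same argument. Rescaling requires [q > 0]; the value [q = 0]
    forces all matrices to vanish in dimension one, where every norm and every convex body
    qualifies, and uniqueness is read off from the identity family. *)

Section Modulus.
Context {R : realType}.
Implicit Types z w : R[i].

Lemma normr_modulus z : `|z| = (modulus z)%:C%C.
Proof. by []. Qed.

Lemma modulus_ge0 z : 0 <= modulus z.
Proof. by rewrite -lecR -normr_modulus normr_ge0. Qed.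

Lemma modulusD z w : modulus (z + w) <= modulus z + modulus w.
Proof. by rewrite -lecR rmorphD /=; exact: (@ler_normD _ R[i]). Qed.

Lemma modulusM z w : modulus (z * w) = modulus z * modulus w.
Proof. exact: Normc.normcM. Qed.

Lemma modulus1 : modulus (1 : R[i]) = 1.
Proof. exact: Normc.normc1. Qed.

Lemma modulus0 : modulus (0 : R[i]) = 0.
Proof. exact: Normc.normc0. Qed.

Lemma modulus_eq0 z : (modulus z == 0) = (z == 0).
Proof.
by apply/eqP/eqP => [/Normc.eq0_normc // | ->]; rewrite modulus0.
Qed.

Lemma modulusX z k : modulus (z ^+ k) = modulus z ^+ k.
Proof.
by elim: k => [|k IH]; rewrite ?expr0 ?modulus1// !exprS modulusM IH.
Qed.

Lemma modulus_real (x : R) : modulus x%:C%C = `|x|.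
Proof. by rewrite /modulus /= expr0n /= addr0 sqrtr_sqr. Qed.

Lemma modulus_sum (I : Type) (r : seq I) (F : I -> R[i]) :
  modulus (\sum_(i <- r) F i) <= \sum_(i <- r) modulus (F i).
Proof.
elim/big_ind2 : _ => //; first by rewrite modulus0.
by move=> x a y b xa yb; rewrite (le_trans (modulusD _ _))// lerD.
Qed.

Lemma modulus_prod (I : Type) (r : seq I) (F : I -> R[i]) :
  modulus (\prod_(i <- r) F i) = \prod_(i <- r) modulus (F i).
Proof.
by apply: (big_morph _ modulusM modulus1).
Qed.

End Modulus.

(** One-sided: the upper limit is at most [0]. Comparison with a larger vanishing sequence is then
    enough, whatever the signs. *)
Definition vanishing {R : realType} (e : nat -> R) :=
  forall eta, 0 < eta -> exists N, forall k, (N <= k)%N -> e k < eta.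

Section Vanishing.
Context {R : realType}.
Implicit Types e f : nat -> R.

Lemma vanishing_expr (a : R) : 0 <= a < 1 -> vanishing (fun k => a ^+ k).
Proof.
move=> /andP[a0 a1] eta eta0.
have /cvgrPdist_lt/(_ eta eta0)[N _ HN] : a ^+ k @[k --> \oo] --> (0 : R).
  by apply: cvg_expr; rewrite ger0_norm.
exists N => k /HN; rewrite sub0r normrN => h.
exact: le_lt_trans (ler_norm _) h.
Qed.

Lemma vanishingD e f :
  vanishing e -> vanishing f -> vanishing (fun k => e k + f k).
Proof.
move=> he hf eta eta0; have eta2 : 0 < eta / 2 by rewrite divr_gt0.
have [N HN] := he _ eta2; have [M HM] := hf _ eta2.
exists (maxn N M) => k; rewrite geq_max => /andP[/HN ? /HM ?].
by rewrite [eta]splitr ltrD.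
Qed.

Lemma vanishingZ e (c : R) :
  0 <= c -> vanishing e -> vanishing (fun k => c * e k).
Proof.
rewrite le_eqVlt => /orP[/eqP <-|c0] he eta eta0.
  by exists 0%N => k _; rewrite mul0r.
have [N HN] := he _ (divr_gt0 eta0 c0).
by exists N => k /HN; rewrite ltr_pdivlMr// mulrC.
Qed.

Lemma vanishing_le e f :
  (forall k, e k <= f k) -> vanishing f -> vanishing e.
Proof.
move=> ef hf eta eta0; have [N HN] := hf _ eta0.
by exists N => k /HN; exact: le_lt_trans.
Qed.

Lemma vanishing_sum (I : Type) (r : seq I) (e : I -> nat -> R) :
  (forall i, vanishing (e i)) -> vanishing (fun k => \sum_(i <- r) e i k).
Proof.
move=> he; elim: r => [|i r IH].
  by move=> eta eta0; exists 0%N => k _; rewrite big_nil.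
apply: vanishing_le (vanishingD (he i) IH) => k.
by rewrite big_cons.
Qed.

(** Once [f] is below [eta / 2 * (1 - a)], the recursion is dominated by an affine contraction with
    fixed point [eta / 2], and the initial excess decays like [a ^+ k]. *)
Lemma vanishing_recurrence e f (a : R) : 0 <= a < 1 ->
  (forall k, e k.+1 <= a * e k + f k) -> vanishing f -> vanishing e.
Proof.
move=> /[dup] aI /andP[a0 a1] ef hf eta eta0.
have b0 : 0 < 1 - a by rewrite subr_gt0.
have [N HN] := hf _ (mulr_gt0 (divr_gt0 eta0 (ltr0Sn _ 1)) b0).
have [M HM] := vanishingZ (normr_ge0 (e N)) (vanishing_expr aI)
  (divr_gt0 eta0 (ltr0Sn _ 1)).
have key k : e (k + N)%N <= `|e N| * a ^+ k + eta / 2.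
  elim: k => [|k IH].
    by rewrite expr0 mulr1 add0n (le_trans (ler_norm _))// lerDl divr_ge0// ltW.
  rewrite addSn (le_trans (ef _))//.
  apply: (@le_trans _ _ (a * (`|e N| * a ^+ k + eta / 2) + eta / 2 * (1 - a))).
    by rewrite lerD ?ler_wpM2l// ltW// HN// leq_addl.
  rewrite exprS le_eqVlt; apply/orP; left; apply/eqP; ring.
exists (M + N)%N => k kMN.
have [j -> jM] : exists2 j, k = (j + N)%N & (M <= j)%N.
  by exists (k - N)%N; lia.
rewrite (le_lt_trans (key j))// [ltRHS]splitr ltrD2r; exact: HM.
Qed.

Lemma vanishing_not_ge e (c : R) : 0 < c -> vanishing e -> ~ (forall k, c <= e k).
Proof.
by move=> c0 /(_ c c0)[N HN] ce; have := HN N (leqnn N); rewrite ltNge ce.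
Qed.

End Vanishing.

Section MxNorm.
Context {R : realType}.

Lemma entry_le_norm m n (A : 'M[R]_(m, n)) i j : `|A i j| <= `|A|.
Proof.
rewrite [leRHS]/Num.norm /= mx_normrE.
by apply/bigmax_geP; right => /=; exists (i, j).
Qed.

Lemma norm_leP m n (A : 'M[R]_(m, n)) (c : R) : 0 <= c ->
  (forall i j, `|A i j| <= c) -> `|A| <= c.
Proof.
move=> c0 h; rewrite [leLHS]/Num.norm /= mx_normrE.
by apply/bigmax_leP; split => // -[i j] _; exact: h.
Qed.

Lemma norm_mulmx m n p (A : 'M[R]_(m, n)) (B : 'M[R]_(n, p)) :
  `|A *m B| <= n%:R * `|A| * `|B|.
Proof.
apply: norm_leP => [|i j]; first by rewrite !mulr_ge0.
rewrite mxE (le_trans (ler_norm_sum _ _ _))//.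
apply: (@le_trans _ _ (\sum_(k < n) `|A| * `|B|)).
  apply: ler_sum => k _; rewrite normrM.
  by apply: ler_pM; rewrite ?entry_le_norm.
by rewrite sumr_const card_ord -mulrA mulr_natl.
Qed.

End MxNorm.

Section Powers.
Context {R : realType} {n : nat}.
Implicit Types (S : 'M[R]_n.+1) (M : 'M[R[i]]_n.+1).

Lemma complexifyM S T : complexify (S *m T) = complexify S *m complexify T.
Proof. exact: map_mxM. Qed.

Lemma complexifyX S k : complexify (S ^+ k) = complexify S ^+ k.
Proof. by rewrite /complexify rmorphXn. Qed.

(** Peeling off one factor replaces a Jordan form: [w M = z w + w (M - z)] yields a recurrence with
    ratio [modulus z < 1], whose error term comes from [w (M - z)] and vanishes by induction. *)
Lemma vanishing_powers_cofactor (s : seq R[i]) M (w : 'rV[R[i]]_n.+1) :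
  (forall z, z \in s -> modulus z < 1) ->
  w *m \prod_(z <- s) (M - z%:M) = 0 ->
  vanishing (fun k => \sum_j modulus ((w *m M ^+ k) 0 j)).
Proof.
elim: s w => [|z s IH] w s1.
  rewrite big_nil mulmx1 => -> eta eta0; exists 0%N => k _.
  by rewrite big1// => j _; rewrite mul0mx mxE modulus0.
rewrite big_cons -mulmxE mulmxA => /IH h.
have zs x : x \in s -> modulus x < 1.
  by move=> xs; apply: s1; rewrite in_cons xs orbT.
apply: vanishing_recurrence (h zs).
  by apply/andP; split; [exact: modulus_ge0 | apply: s1; rewrite mem_head].
move=> k; rewrite mulr_sumr -big_split /=; apply: ler_sum => j _.
rewrite exprS -mulmxE mulmxA.
have -> : w *m M = z *: w + w *m (M - z%:M).
  by rewrite mulmxBr mul_mx_scalar addrC subrK.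
rewrite mulmxDl -scalemxAl !mxE (le_trans (modulusD _ _))// modulusM; exact: lexx.
Qed.

Lemma char_poly_roots M : exists s : seq R[i],
  char_poly M = \prod_(z <- s) ('X - z%:P) /\
  forall z, (z \in s) = eigenvalue M z.
Proof.
have [s Hs] := closed_field_poly_normal (char_poly M).
move: Hs; rewrite (monicP (char_poly_monic M)) scale1r => Hs; exists s.
by split=> // z; rewrite eigenvalue_root_char Hs root_prod_XsubC.
Qed.

(** By Cayley-Hamilton the product of the [M - z] over all eigenvalues kills every row, so the
    preceding lemma applies to each basis row. *)
Lemma vanishing_powers S :
  (forall z, eigenvalue (complexify S) z -> modulus z < 1) ->
  vanishing (fun k => `|S ^+ k|).
Proof.
move=> h; have [s [Hs es]] := char_poly_roots (complexify S).
have s1 z : z \in s -> modulus z < 1 by rewrite es; exact: h.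
have prod0 : \prod_(z <- s) (complexify S - z%:M) = 0.
  rewrite -(Cayley_Hamilton (complexify S)) Hs rmorph_prod /=.
  apply: eq_bigr => z _.
  by rewrite raddfB /= horner_mx_X horner_mx_C.
have van i : vanishing (fun k =>
    \sum_j modulus (((delta_mx 0 i : 'rV[R[i]]_n.+1) *m complexify S ^+ k) 0 j)).
  by apply: (@vanishing_powers_cofactor s (complexify S) (delta_mx 0 i) s1); rewrite prod0 mulmx0.
apply: vanishing_le (vanishing_sum (index_enum 'I_n.+1) van) => k.
apply: norm_leP => [|i j].
  by do 2!apply: sumr_ge0 => ? _; exact: modulus_ge0.
rewrite (bigD1 i)//= (bigD1 j)//= -rowE mxE -complexifyX mxE modulus_real.
rewrite -addrA lerDl addr_ge0//.
  by apply: sumr_ge0 => ? _; exact: modulus_ge0.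
by do 2!apply: sumr_ge0 => ? _; exact: modulus_ge0.
Qed.

End Powers.

(** * Simple eigenvalues *)

Section RankOneDet.

(** The bordered matrix [B] is made block triangular in two ways. The extra factor [c] avoids a
    division, since [c] will be the polynomial ['X - a]. *)
Lemma det_scalar_rank1 (K : comNzRingType) n (c : K) (v : 'cV[K]_n) (y : 'rV[K]_n) :
  c * \det (c%:M + v *m y) = c ^+ n * (c + (y *m v) 0 0).
Proof.
pose B : 'M[K]_(n + 1) := block_mx c%:M (- v) y 1%:M.
have B1 : \det B = \det (c%:M + v *m y).
  have : B *m block_mx 1%:M 0 (- y) 1%:M = block_mx (c%:M + v *m y) (- v) 0 1%:M.
    rewrite mulmx_block !mulmx1 !mulmx0 !add0r mulNmx mulmxN opprK mul1mx.
    by rewrite subrr.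
  move/(congr1 determinant); rewrite det_mulmx det_lblock det_ublock !det1.
  by rewrite !mulr1.
have : block_mx 1%:M 0 (- y) c%:M *m B
    = block_mx c%:M (- v) 0 (c%:M + y *m v) :> 'M[K]_(n + 1).
  rewrite mulmx_block !mul1mx !mul0mx !addr0 !mulNmx mulmxN opprK.
  by rewrite mul_mx_scalar mul_scalar_mx addNr mulmx1 addrC.
move/(congr1 determinant); rewrite det_mulmx det_lblock det_ublock det1 mul1r.
rewrite B1 !det_scalar expr1 det_mx11 => ->; congr (_ * _).
by rewrite mxE [c%:M _ _]mxE eqxx mulr1n.
Qed.

(** Deflation: since [(X - M) v = (X - a) v], one has [(X - M) ((X - a) + v y) = (X - a) (X - M + v
    y)]. Taking determinants and cancelling powers of [X - a] moves the root [a] to [a - y v]. *)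
Lemma char_poly_rank1_update (K : fieldType) n (M : 'M[K]_n.+1) (a : K)
    (v : 'cV[K]_n.+1) (y : 'rV[K]_n.+1) : M *m v = a *: v ->
  char_poly M * ('X - (a - (y *m v) 0 0)%:P)
    = ('X - a%:P) * char_poly (M - v *m y).
Proof.
move=> Mv; set c := 'X - a%:P.
have c0 : c != 0 by rewrite polyXsubC_eq0.
pose v' := map_mx polyC v; pose y' := map_mx polyC y.
have cv : char_poly_mx M *m v' = c *: v'.
  rewrite /char_poly_mx mulmxBl -map_mxM Mv mul_scalar_mx.
  apply/matrixP => i j; rewrite !mxE /c mulrBl.
  by congr (_ - _); exact: polyCM.
have E : char_poly_mx M *m (c%:M + v' *m y') = c *: char_poly_mx (M - v *m y).
  rewrite mulmxDr mul_mx_scalar mulmxA cv -scalemxAl -scalerDr; congr (_ *: _).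
  by rewrite /char_poly_mx raddfB /= opprB /v' /y' -map_mxM /= addrA addrAC.
have yv : (y' *m v') 0 0 = ((y *m v) 0 0)%:P by rewrite -map_mxM mxE.
have D := congr1 determinant E.
rewrite det_mulmx detZ in D.
have D' : c ^+ n.+1 * (char_poly M * (c + ((y *m v) 0 0)%:P))
    = c ^+ n.+1 * (c * char_poly (M - v *m y)).
  by rewrite -yv mulrCA -det_scalar_rank1 mulrCA /char_poly D mulrCA.
move/(mulfI (expf_neq0 _ c0)): D'.
by rewrite /c raddfB /= opprB addrA => <-; rewrite addrAC.
Qed.

(** If [x v = 0], then [x] remains an eigenvector of [M - v y] for [a]. With [y v = 1] the deflation
    has already traded one factor [X - a] for [X - (a - 1)], so [a] would be at least a double root
    of [char_poly M]. *)
Lemma simple_eigen_pairing (K : fieldType) n (M : 'M[K]_n.+1) (a : K)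
    (v : 'cV[K]_n.+1) (x : 'rV[K]_n.+1) :
  M *m v = a *: v -> v != 0 -> x *m M = a *: x -> x != 0 ->
  mup a (char_poly M) = 1%N -> x *m v != 0.
Proof.
move=> Mv v0 xM x0 simple; apply/eqP => xv.
have /cV0Pn[j vj] := v0.
pose y : 'rV[K]_n.+1 := (v j 0)^-1 *: delta_mx 0 j.
have yv : (y *m v) 0 0 = 1.
  by rewrite /y -scalemxAl -rowE !mxE mulVf.
have := char_poly_rank1_update y Mv; rewrite yv.
have rt : root (char_poly (M - v *m y)) a.
  rewrite -eigenvalue_root_char; apply/eigenvalueP; exists x => //.
  by rewrite mulmxBr mulmxA xv mul0mx subr0.
have cp0 (N : 'M[K]_n.+1) : char_poly N != 0.
  by rewrite monic_neq0// char_poly_monic.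
move/(congr1 (mup a)); rewrite mupMl; last first.
  by rewrite root_XsubC -subr_eq0 opprB addrCA subrr addr0 oner_eq0.
rewrite simple mupM ?polyXsubC_eq0// (@mup_XsubCX _ 1) eqxx.
have : (0 < mup a (char_poly (M - v *m y)))%N by rewrite -XsubC_dvd// dvdp_XsubCl.
by case: mup.
Qed.

End RankOneDet.

(** * Nonnegative matrices *)

Section NonnegMatrices.
Context {R : realType} {n : nat}.
Implicit Types (S M : 'M[R]_n.+1).

Definition nonneg_mx S := forall i j, 0 <= S i j.

Lemma nonneg_mx1 : nonneg_mx 1%:M.
Proof. by move=> i j; rewrite mxE; case: eqP. Qed.

Lemma nonneg_mxM S M : nonneg_mx S -> nonneg_mx M -> nonneg_mx (S *m M).
Proof. by move=> hS hM i j; rewrite mxE sumr_ge0// => k _; rewrite mulr_ge0. Qed.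

Lemma nonneg_mxX S k : nonneg_mx S -> nonneg_mx (S ^+ k).
Proof.
move=> hS; elim: k => [|k IH]; first by rewrite expr0; exact: nonneg_mx1.
by rewrite exprS; exact: nonneg_mxM.
Qed.

Lemma eigenvalue_scale S (a : R) (z : R[i]) : a != 0 ->
  eigenvalue (complexify (a *: S)) z ->
  eigenvalue (complexify S) (a^-1%:C%C * z).
Proof.
move=> a0 /eigenvalueP[x xS x0]; apply/eigenvalueP; exists x => //.
rewrite -scalerA -xS /complexify map_mxZ -scalemxAr scalerA -rmorphM /=.
by rewrite mulVf// scale1r.
Qed.

Lemma eigenvalue_scaleV S (a : R) (z : R[i]) :
  eigenvalue (complexify S) z -> eigenvalue (complexify (a *: S)) (a%:C%C * z).
Proof.
move=> /eigenvalueP[x xS x0]; apply/eigenvalueP; exists x => //.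
by rewrite /complexify map_mxZ -scalemxAr -[map_mx _ S]/(complexify S) xS scalerA.
Qed.

(** If [a = S k k > 1], all eigenvalues of [S / a] have modulus below [1] and its powers vanish; but
    its diagonal entry at [k] is [1], and by nonnegativity it stays at least [1] in every power. *)
Lemma nonneg_diag_le1 S (k : 'I_n.+1) : nonneg_mx S ->
  (forall z, eigenvalue (complexify S) z -> modulus z <= 1) -> S k k <= 1.
Proof.
move=> S0 S1; rewrite leNgt; apply/negP => a1; set a := S k k in a1.
have a0 : 0 < a by apply: lt_trans a1.
pose T := a^-1 *: S.
have T0 : nonneg_mx T by move=> i j; rewrite mxE mulr_ge0// invr_ge0 ltW.
have van : vanishing (fun j => `|T ^+ j|).
  apply: vanishing_powers => z /eigenvalue_scale.
  rewrite invr_eq0 gt_eqF// invrK => /(_ isT) /S1.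
  rewrite modulusM modulus_real gtr0_norm// => az.
  by rewrite -(ltr_pM2l a0) mulr1 (le_lt_trans az).
apply: (vanishing_not_ge ltr01 van) => j.
suff T1 : 1 <= (T ^+ j) k k.
  by rewrite (le_trans T1)// (le_trans (ler_norm _))// entry_le_norm.
elim: j => [|j IH]; first by rewrite expr0 mxE eqxx.
rewrite exprS -mulmxE mxE (bigD1 k)//=.
have -> : T k k = 1 by rewrite mxE -/a mulVf// gt_eqF.
rewrite mul1r (le_trans IH)// lerDl sumr_ge0// => i _.
by rewrite mulr_ge0//; exact: nonneg_mxX.
Qed.

Lemma eigenvalue_power M (z : R[i]) k (x : 'rV[R[i]]_n.+1) :
  x *m complexify M = z *: x -> x *m complexify M ^+ k = z ^+ k *: x.
Proof.
move=> xM; elim: k => [|k IH]; first by rewrite !expr0 mulmx1 scale1r.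
by rewrite exprSr -mulmxE mulmxA IH -scalemxAl xM scalerA -exprSr.
Qed.

(* The Perron-Frobenius statement that the modulus of a peripheral eigenvalue
   is an eigenvalue: otherwise [\sum_(k < N) S ^+ k] equals
   [(1 - S)^-1 * (1 - S ^+ N)] and stays bounded, whereas the sum of the
   entries of each nonnegative [S ^+ k] is at least [1]. *)
Lemma nonneg_peripheral S (z : R[i]) (C : R) : nonneg_mx S ->
  eigenvalue (complexify S) z -> modulus z = 1 ->
  (forall k, `|S ^+ k| <= C) -> 1%:M - S \notin unitmx.
Proof.
move=> S0 /eigenvalueP[x xS x0] z1 SC; apply/negP => U.
pose sum_entries (M : 'M[R]_n.+1) := \sum_i \sum_j M i j.
(* Taking moduli in [x S^k = z^k x] bounds each [|x_j|] by an entry of [|x| S^k]. After summation,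
   every row sum is bounded by the sum of all entries. *)
have sum1 k : 1 <= sum_entries (S ^+ k).
  pose N := \sum_j modulus (x 0 j).
  have N0 : 0 < N.
    have /rV0Pn[j xj] := x0.
    rewrite /N (bigD1 j)//= ltr_pwDl//.
      by rewrite lt_def modulus_eq0 xj modulus_ge0.
    by apply: sumr_ge0 => i _; exact: modulus_ge0.
  rewrite -(ler_pM2l N0) mulr1 /N.
  apply: (@le_trans _ _ (\sum_j \sum_i modulus (x 0 i) * (S ^+ k) i j)).
    apply: ler_sum => j _.
    have -> : modulus (x 0 j) = modulus ((x *m complexify S ^+ k) 0 j).
      by rewrite (eigenvalue_power _ xS) mxE modulusM modulusX z1 expr1n mul1r.
    rewrite mxE (le_trans (modulus_sum _ _))//; apply: ler_sum => i _.
    rewrite modulusM -complexifyX mxE modulus_real ger0_norm//.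
    exact: nonneg_mxX.
  rewrite exchange_big mulr_suml; apply: ler_sum => i _ /=.
  rewrite -mulr_sumr ler_wpM2l ?modulus_ge0//.
  rewrite /sum_entries [leRHS](bigD1 i)//= lerDl.
  by do 2!apply: sumr_ge0 => ? _; exact: nonneg_mxX.
have sumle (M : 'M[R]_n.+1) : sum_entries M <= n.+1%:R * (n.+1%:R * `|M|).
  rewrite /sum_entries; apply: (@le_trans _ _ (\sum_(i < n.+1) \sum_(j < n.+1) `|M|)).
    do 2!apply: ler_sum => ? _.
    by rewrite (le_trans (ler_norm _))// entry_le_norm.
  by rewrite !sumr_const !card_ord !mulr_natl.
have geom N : \sum_(k < N) S ^+ k = invmx (1%:M - S) *m (1%:M - S ^+ N).
  apply: (canRL (mulKmx U)); rewrite !mulmxE.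
  elim: N => [|N IH]; first by rewrite big_ord0 mulr0 expr0 subrr.
  rewrite big_ord_recr /= mulrDr IH mulrBl mul1r -exprS.
  by rewrite addrA subrK.
pose K := n.+1%:R * (n.+1%:R * (n.+1%:R * `|invmx (1%:M - S)| * (`|1%:M : 'M[R]_n.+1| + C))).
have KN N : N%:R <= K.
  apply: (@le_trans _ _ (sum_entries (\sum_(k < N) S ^+ k))).
    rewrite /sum_entries; under eq_bigr do under eq_bigr do rewrite summxE.
    under eq_bigr do rewrite exchange_big /=.
    rewrite exchange_big /= -[leLHS]mulr1 mulr_natl.
    apply: (@le_trans _ _ (\sum_(k < N) 1)); first by rewrite sumr_const card_ord.
    by apply: ler_sum => k _; exact: sum1.
  rewrite (le_trans (sumle _))// geom /K !ler_pM2l ?ltr0Sn//.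
  rewrite (le_trans (norm_mulmx _ _))// ler_wpM2l ?mulr_ge0//.
  by rewrite (le_trans (ler_normB _ _))// lerD2l.
have := KN (Num.truncn K).+1.
by rewrite leNgt truncnS_gt.
Qed.

(* [v *m u] is the spectral projection on the leading eigenspace. *)
Lemma leading_projection S (C : R) : nonneg_mx S ->
  has_unique_simple_leading_eigenvalue S ->
  (exists2 z, eigenvalue (complexify S) z & modulus z = 1) ->
  (forall z, eigenvalue (complexify S) z -> modulus z <= 1) ->
  (forall k, `|S ^+ k| <= C) ->
  exists (u : 'rV[R]_n.+1) (v : 'cV[R]_n.+1),
    [/\ u *m S = u, S *m v = v, u *m v = 1%:M &
        vanishing (fun k => `|(S - v *m u) ^+ k|)].
Proof.
move=> S0 [z [[ez lez] simple uniq]] [z' ez' z'1] le1 SC.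
have z1 : modulus z = 1.
  by apply/eqP; rewrite eq_le le1//= -z'1 lez.
have U := nonneg_peripheral S0 ez z1 SC.
have detB0 : \det (1%:M - S) = 0.
  by apply/eqP; move: U; rewrite unitmxE unitfE negbK.
have /det0P[u0 u0n0 u0S] : \det (1%:M - S) == 0 by rewrite detB0.
have /det0P[v0 v0n0 v0S] : \det (1%:M - S)^T == 0 by rewrite det_tr detB0.
have uS : u0 *m S = u0.
  by move: u0S; rewrite mulmxBr mulmx1 => /eqP; rewrite subr_eq0 eq_sym => /eqP.
pose v := v0^T.
have vS : S *m v = v.
  have := congr1 trmx v0S; rewrite trmx_mul trmxK trmx0 -/v mulmxBl mul1mx.
  by move/eqP; rewrite subr_eq0 eq_sym => /eqP.
have vn0 : v != 0.
  by apply: contraNneq v0n0 => /(congr1 trmx); rewrite trmxK trmx0 => ->.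
pose toC k l (M : 'M[R]_(k, l)) : 'M[R[i]]_(k, l) := map_mx (real_complex R) M.
have toC0 k l (M : 'M[R]_(k, l)) : (toC _ _ M == 0) = (M == 0) by rewrite map_mx_eq0.
have e1 : eigenvalue (complexify S) 1.
  apply/eigenvalueP; exists (toC _ _ u0); last by rewrite toC0.
  by rewrite scale1r /toC -map_mxM uS.
(* The eigenvalue [1] has the same modulus as [z], so uniqueness makes it [z] or the conjugate of
   [z]. *)
have zE : z = 1.
  apply/eqP; apply: contraT => zn1; have := uniq 1 e1.
  rewrite eq_sym zn1 modulus1 z1 ltxx => /(_ isT); apply.
  apply: contraNneq zn1 => E; rewrite -[z]conjcK -E.
  by rewrite /= oppr0.
rewrite zE in simple.
have pair (x : 'rV[R[i]]_n.+1) : x *m complexify S = x -> x != 0 -> x *m toC _ _ v != 0.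
  move=> xS x0; apply: (simple_eigen_pairing _ _ _ x0 simple).
  - by rewrite scale1r /complexify -map_mxM vS.
  - by rewrite toC0.
  - by rewrite scale1r.
have uv0 : u0 *m v != 0.
  rewrite -toC0 /toC map_mxM; apply: pair; last by rewrite toC0.
  by rewrite /complexify -map_mxM uS.
pose c := (u0 *m v) 0 0.
have c0 : c != 0.
  apply: contraNneq uv0 => c0; apply/eqP/matrixP => i j.
  by rewrite !ord1 [RHS]mxE.
pose u := c^-1 *: u0.
have uv : u *m v = 1%:M.
  apply/matrixP => i j; rewrite !ord1 /u -scalemxAl [LHS]mxE [RHS]mxE eqxx.
  by rewrite mulVf.
have uS' : u *m S = u by rewrite /u -scalemxAl uS.
exists u, v; split => //.
(* An eigenvector [x] of [S - v u] for [y != 0] satisfies [x v = 0], because [(S - v u) v = 0]. It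
   is then an eigenvector of [S] for [y], and [y = 1] is excluded by the pairing with [v]. *)
apply: vanishing_powers => y /eigenvalueP[x xT x0].
have [->|y0] := eqVneq y 0; first by rewrite modulus0.
have TE : complexify (S - v *m u) = complexify S - toC _ _ v *m toC _ _ u.
  by rewrite /complexify /toC -map_mxM raddfB.
have xv : x *m toC _ _ v = 0.
  have := congr1 (mulmx^~ (toC _ _ v)) xT; rewrite TE mulmxBr mulmxBl.
  rewrite -!mulmxA -[toC _ _ u *m _]map_mxM uv map_mx1 mulmx1.
  rewrite -[complexify S *m _]map_mxM vS subrr -scalemxAl => /esym/eqP.
  by rewrite scaler_eq0 (negbTE y0) => /eqP.
have xS : x *m complexify S = y *: x.
  by rewrite -xT TE mulmxBr mulmxA xv mul0mx subr0.
have ey : eigenvalue (complexify S) y by apply/eigenvalueP; exists x.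
rewrite -modulus1 -zE; apply: uniq => //.
  rewrite zE; apply: contraNneq x0 => y1.
  apply: contraT => xn0; have := pair x.
  by rewrite xS y1 scale1r xv eqxx => /(_ erefl xn0).
rewrite zE conjc1; apply: contraNneq x0 => y1.
apply: contraT => xn0; have := pair x.
by rewrite xS y1 scale1r xv eqxx => /(_ erefl xn0).
Qed.

End NonnegMatrices.

(** * Compactness, the spectral gap and words *)

Lemma lipschitz_continuous {R : realType} {V W : normedModType R} (f : V -> W) (K : R) :
  (forall x y, `|f x - f y| <= K * `|x - y|) -> continuous f.
Proof.
move=> lip x; apply/cvgrPdist_lt => e e0.
have K0 : 0 < `|K| + 1 by rewrite ltr_wpDl.
near=> y.
rewrite (le_lt_trans (lip x y))//.
apply: (@le_lt_trans _ _ ((`|K| + 1) * `|x - y|)).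
  by rewrite ler_wpM2r// (le_trans (ler_norm K))// lerDl.
rewrite mulrC -ltr_pdivlMr//.
near: y; apply: cvgr_dist_lt; first exact: cvg_id.
by rewrite divr_gt0.
Unshelve. all: by end_near. Qed.

Section ColumnCompactness.
Context {R : realType} {n : nat}.

Lemma norm_trmx (x : 'rV[R]_n) : `|x^T| = `|x|.
Proof.
apply/eqP; rewrite eq_le; apply/andP; split; apply: norm_leP => // i j.
  by rewrite mxE entry_le_norm.
by have := entry_le_norm x^T j i; rewrite mxE.
Qed.

Lemma closed_ball_cV_compact (c : R) : compact [set x : 'cV[R]_n | `|x| <= c].
Proof.
have -> : [set x : 'cV[R]_n | `|x| <= c] =
    (fun x : 'rV[R]_n => x^T) @` [set x | `|x| <= c].
  apply/seteqP; split => [x /= xc|_ [x /= xc <-]]; last by rewrite norm_trmx.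
  by exists x^T; rewrite ?trmxK// -norm_trmx trmxK.
apply: continuous_compact.
  apply/continuous_subspaceT/(@lipschitz_continuous _ _ _ _ 1) => x y.
  by rewrite -raddfB /= norm_trmx mul1r.
apply: bounded_closed_compact.
  exists c; split; first exact: num_real.
  by move=> M cM x /= xc; rewrite (le_trans xc)// ltW.
rewrite (_ : mkset _ = (@Num.norm _ 'rV[R]_n) @^-1` [set y : R | y <= c])//.
apply: closed_comp; last exact: closed_le.
by move=> x _; exact: norm_continuous.
Qed.

Lemma bounded_cluster (x : nat -> 'cV[R]_n) (c : R) : (forall k, `|x k| <= c) ->
  exists y, forall e N, 0 < e -> exists2 k, (N <= k)%N & `|x k - y| < e.
Proof.
move=> xc.
have [|y [_ yx]] := @closed_ball_cV_compact c (x k @[k --> \oo]) _.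
  by exists 0%N => // k _ /=.
exists y => e N e0.
have [] := yx (x @` [set k | (N <= k)%N]) (ball y e).
- by exists N => // k /= Nk; exists k.
- exact: nbhsx_ballx.
move=> _ [[k /= Nk <-]]; rewrite -ball_normE /= distrC => h.
by exists k.
Qed.

End ColumnCompactness.

Section FixedGap.
Context {R : realType} {n : nat}.

Lemma det_bound k (M : 'M[R]_k) (c : R) :
  (forall i j, `|M i j| <= c) -> `|\det M| <= (k`!)%:R * c ^+ k.
Proof.
move=> Mc; rewrite /determinant (le_trans (ler_norm_sum _ _ _))//.
apply: (@le_trans _ _ (\sum_(s : 'S_k) c ^+ k)); last first.
  by rewrite sumr_const card_Sn mulr_natl.
apply: ler_sum => s _; rewrite normrM normrX normrN1 expr1n mul1r normr_prod.
rewrite -[X in c ^+ X]card_ord -prodr_const.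
by apply: ler_prod => i _; rewrite normr_ge0 Mc.
Qed.

(* [\adj (1 - M) *m (1 - M) = \det (1 - M)], and the determinant is the
   product of the [1 - z] over the eigenvalues [z]. *)
Lemma fixed_gap (r C : R) : r < 1 -> exists2 K, 0 < K &
  forall (M : 'M[R]_n.+1) (y : 'cV[R]_n.+1), `|M| <= C ->
    (forall z, eigenvalue (complexify M) z -> modulus z <= r) ->
    `|y| <= K * `|M *m y - y|.
Proof.
move=> r1; have e0 : 0 < 1 - r by rewrite subr_gt0.
(* Bounds a cofactor of [1 - M]: an [n] by [n] determinant with entries of modulus at most
   [1 + |C|]. *)
pose D : R := (n`!)%:R * (1 + `|C|) ^+ n.
have D0 : 0 < D by rewrite mulr_gt0 ?exprn_gt0 ?ltr_wpDr// ltr0n fact_gt0.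
exists (n.+1%:R * D / (1 - r) ^+ n.+1).
  by rewrite divr_gt0 ?exprn_gt0// mulr_gt0// ltr0n.
move=> M y MC Mr; rewrite mulrAC ler_pdivlMr ?exprn_gt0// mulrC.
pose B := 1%:M - M.
have detB : (1 - r) ^+ n.+1 <= `|\det B|.
  have [s [Hs es]] := char_poly_roots (complexify M).
  have -> : `|\det B| = modulus ((char_poly (complexify M)).[1]).
    rewrite -map_char_poly -[1](rmorph1 (real_complex R)) horner_map.
    rewrite modulus_real; congr `|_|.
    rewrite /char_poly -horner_evalE -det_map_mx; congr (\det _).
    apply/matrixP => i j; rewrite !mxE /= /horner_eval hornerD hornerN hornerC.
    by rewrite hornerMn hornerX.
  rewrite Hs horner_prod modulus_prod.
  have szs : size s = n.+1.
    have := size_char_poly (complexify M).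
    by rewrite Hs size_prod_XsubC => -[].
  have : forall z, z \in s -> 1 - r <= modulus (('X - z%:P).[1]).
    move=> z; rewrite es => /Mr zr; rewrite !hornerE.
    have := modulusD (1 - z) z; rewrite subrK modulus1; lra.
  rewrite -szs; elim: (s) => [|z l IH] h; first by rewrite big_nil expr0.
  rewrite big_cons exprS; apply: ler_pM; [exact: ltW| |exact/h/mem_head|].
    exact/ltW/exprn_gt0.
  by apply: IH => w wl; apply: h; rewrite in_cons wl orbT.
have adjB : `|\adj B| <= D.
  apply: norm_leP => [|i j]; first exact: ltW.
  rewrite mxE /cofactor normrM normrX normrN1 expr1n mul1r.
  apply: det_bound => a b; rewrite 2!mxE /B.
  rewrite !mxE (le_trans (ler_normB _ _))// lerD//.
    by case: (_ == _); rewrite ?mulr1n ?mulr0n ?normr1 ?normr0.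
  by rewrite (le_trans (entry_le_norm _ _ _))// (le_trans MC)// ler_norm.
apply: (@le_trans _ _ `|\det B *: y|).
  by rewrite normrZ ler_wpM2r.
rewrite -mul_scalar_mx -mul_adj_mx -mulmxA.
have -> : B *m y = - (M *m y - y) by rewrite mulmxBl mul1mx opprB.
rewrite mulmxN normrN (le_trans (norm_mulmx _ _))//.
by rewrite ler_wpM2r// ler_wpM2l.
Qed.

End FixedGap.

Lemma word_prod_cat (R : realType) n (s t : seq 'M[R]_n) :
  word_prod (s ++ t) = word_prod s *m word_prod t.
Proof. by elim: s => [|a s IH] /=; rewrite ?mul1mx// IH mulmxA. Qed.

Section Words.
Context {R : realType} {n : nat}.
Implicit Types (M : 'M[R[i]]_n.+1) (s t p : seq 'M[R]_n.+1).

(** The successive factors carry [x] to [0]; the last nonzero vector on the way is an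
    eigenvector. *)
Lemma eigenvalue_of_factor (l : seq R[i]) M (x : 'rV[R[i]]_n.+1) : x != 0 ->
  x *m \prod_(z <- l) (M - z%:M) = 0 -> exists2 z, z \in l & eigenvalue M z.
Proof.
elim: l x => [|z l IH] x x0; first by rewrite big_nil mulmx1 => /eqP; rewrite (negbTE x0).
rewrite big_cons -mulmxE mulmxA.
have [xz _|y0 /(IH _ y0)[w wl ew]] := eqVneq (x *m (M - z%:M)) 0.
  exists z; first exact: mem_head.
  apply/eigenvalueP; exists x => //; apply/eqP.
  by rewrite -subr_eq0 -mul_mx_scalar -mulmxBr xz.
by exists w => //; rewrite in_cons wl orbT.
Qed.

(** Split [X^k - z] into linear factors and evaluate at [M]: the product kills an eigenvector of
    [M ^+ k]. *)
Lemma eigenvalue_of_power M (k : nat) (z : R[i]) : (0 < k)%N ->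
  eigenvalue (M ^+ k) z -> exists2 w, eigenvalue M w & w ^+ k = z.
Proof.
move=> k0 /eigenvalueP[x xM x0].
have [l] := closed_field_poly_normal ('X^k - z%:P).
rewrite (monicP (monicXnsubC _ k0)) scale1r => lE.
have [|w wl ew] := @eigenvalue_of_factor l M x x0.
  rewrite (_ : \prod_(y <- l) (M - y%:M) = M ^+ k - z%:M).
    by rewrite mulmxBr xM mul_mx_scalar subrr.
  have := congr1 (horner_mx M) lE.
  rewrite rmorph_prod rmorphB /= rmorphXn /= horner_mx_X horner_mx_C => ->.
  by apply: eq_bigr => y _; rewrite rmorphB /= horner_mx_X horner_mx_C.
exists w => //; apply/eqP; rewrite -subr_eq0.
have : root ('X^k - z%:P) w by rewrite lE root_prod_XsubC.
by rewrite /root !hornerE.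
Qed.

Lemma eigenvalue_mulmxC (M N : 'M[R[i]]_n.+1) (z : R[i]) : z != 0 ->
  eigenvalue (M *m N) z -> eigenvalue (N *m M) z.
Proof.
move=> z0 /eigenvalueP[x xMN x0]; apply/eigenvalueP; exists (x *m M).
  by rewrite !mulmxA -[x *m M *m N]mulmxA xMN scalemxAl.
apply: contraNneq x0 => xM; move: xMN; rewrite mulmxA xM mul0mx => /esym/eqP.
by rewrite scaler_eq0 (negbTE z0).
Qed.

Lemma word_prod_power s k : word_prod (word_power s k) = word_prod s ^+ k.
Proof.
elim: k => [|k IH]; first by rewrite expr0.
by rewrite /word_power /= word_prod_cat exprS -mulmxE -IH.
Qed.

Lemma size_word_power (T : eqType) (s : seq T) k : size (word_power s k) = (k * size s)%N.
Proof.
elim: k => [//|k IH]; rewrite /word_power /= size_cat.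
by rewrite -/(word_power s k) IH mulSn.
Qed.

(** With [p = T D], the rotated power is [(D T)^(k+1) = D (T D)^k T]. Long powers of a cyclic
    permutation are thus controlled through powers of [word_prod p] itself. *)
Lemma word_prod_rot_power p i k :
  word_prod (word_power (rot i p) k.+1)
    = word_prod (drop i p) *m word_prod p ^+ k *m word_prod (take i p).
Proof.
set D := word_prod (drop i p); set T := word_prod (take i p).
have -> : word_prod p = T *m D by rewrite -word_prod_cat cat_take_drop.
rewrite word_prod_power word_prod_cat -/D -/T.
elim: k => [|k IH]; first by rewrite expr1 expr0 !mulmxE mulr1.
by rewrite exprS IH exprS -!mulmxE !mulmxA.
Qed.

Lemma eigenvalue_rot_power_le p i k (q : R) : (0 < k)%N ->
  (forall z, eigenvalue (complexify (word_prod p)) z -> modulus z <= q) ->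
  forall z, eigenvalue (complexify (word_prod (word_power (rot i p) k))) z ->
    modulus z <= q ^+ k.
Proof.
move=> k0 pq z; rewrite word_prod_power complexifyX.
move=> /(eigenvalue_of_power k0)[w ew <-]; rewrite modulusX.
(* At least one eigenvalue exists, so its modulus forces the bound [q] to be nonnegative. *)
have q0 : 0 <= q.
  have [l [Hl le]] := char_poly_roots (complexify (word_prod p)).
  case: l Hl le => [|y l] Hl le.
    by have := size_char_poly (complexify (word_prod p)); rewrite Hl big_nil size_poly1.
  by apply: le_trans (modulus_ge0 y) (pq y _); rewrite -le mem_head.
have [->|w0] := eqVneq w 0.
  by rewrite modulus0 expr0n gtn_eqF// exprn_ge0.
rewrite lerXn2r ?nnegrE ?modulus_ge0//; apply: pq.
have -> : word_prod p = word_prod (take i p) *m word_prod (drop i p).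
  by rewrite -word_prod_cat cat_take_drop.
move: ew; rewrite word_prod_cat !complexifyM.
exact: eigenvalue_mulmxC.
Qed.

End Words.

(** * Extremal norms *)

Section Norms.
Context {R : realType} {n : nat} (f : 'cV[R]_n -> R) (fN : is_norm f).

Lemma is_normD x y : f (x + y) <= f x + f y.
Proof. by case: fN. Qed.

Lemma is_normZ a x : f (a *: x) = `|a| * f x.
Proof. by case: fN. Qed.

Lemma is_norm0 : f 0 = 0.
Proof. by rewrite -(scale0r 0) is_normZ normr0 mul0r. Qed.

Lemma is_normN x : f (- x) = f x.
Proof. by rewrite -scaleN1r is_normZ normrN1 mul1r. Qed.

Lemma is_norm_ge0 x : 0 <= f x.
Proof.
have := is_normD x (- x); rewrite subrr is_norm0 is_normN.
by rewrite -mulr2n pmulrn_lge0.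
Qed.

Lemma is_norm_gt0 x : x != 0 -> 0 < f x.
Proof.
move=> x0; rewrite lt_def is_norm_ge0 andbT.
by apply: contraNneq x0 => f0; apply/eqP; case: fN => _ _; apply.
Qed.

Lemma is_normB x y : f x - f y <= f (x - y).
Proof. by rewrite lerBlDr (le_trans _ (is_normD _ _))// subrK. Qed.

Lemma is_norm_bound : exists2 K, 0 < K & forall x, f x <= K * `|x|.
Proof.
pose K := \sum_i f (delta_mx i 0).
have K0 : 0 <= K by apply: sumr_ge0 => i _; exact: is_norm_ge0.
exists (K + 1) => [|x]; first by rewrite ltr_wpDl.
apply: (@le_trans _ _ (K * `|x|)); last by rewrite ler_wpM2r// lerDl.
have -> : x = \sum_i x i 0 *: delta_mx i 0.
  rewrite [LHS]matrix_sum_delta; apply: eq_bigr => i _.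
  by rewrite big_ord1.
apply: (@le_trans _ _ (\sum_i f (x i 0 *: delta_mx i 0))).
  elim/big_ind2 : _ => //; first by rewrite is_norm0.
  by move=> a b c d ab cd; rewrite (le_trans (is_normD _ _))// lerD.
rewrite -[in leRHS](_ : x = \sum_i x i 0 *: delta_mx i 0); last first.
  rewrite [LHS]matrix_sum_delta; apply: eq_bigr => i _.
  by rewrite big_ord1.
rewrite mulr_suml; apply: ler_sum => i _.
by rewrite is_normZ mulrC ler_wpM2l ?is_norm_ge0// entry_le_norm.
Qed.

End Norms.

Section ExtremalNorm.
Context {R : realType} {m n : nat}.
Implicit Types (B : 'I_m -> 'M[R]_n.+1) (s t p : seq 'M[R]_n.+1).

(** Unlike [product_word], this admits the empty word, so that the identity is among the
    products. *)
Definition word_over B s : Prop := {subset s <= codom B}.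

Lemma word_over_cat B s t : word_over B s -> word_over B t -> word_over B (s ++ t).
Proof. by move=> hs ht a; rewrite mem_cat => /orP[/hs|/ht]. Qed.

Lemma word_over_power B s k : word_over B s -> word_over B (word_power s k).
Proof.
move=> hs; elim: k => [//|k IH]; rewrite /word_power /=.
exact: word_over_cat.
Qed.

Lemma word_over1 B i : word_over B [:: B i].
Proof. by move=> a; rewrite inE => /eqP ->; exact: codom_f. Qed.

(* Irreducibility enters only through the matrix coefficients, in a form that
   is stable under transposition. *)
Record normalized_family B p (r : R) : Prop := NormalizedFamily {
  nf_nonneg : forall i, nonneg_mx (B i);
  nf_irreducible : forall (y : 'rV[R]_n.+1) (v : 'cV[R]_n.+1), y != 0 -> v != 0 ->
    exists2 s, word_over B s & y *m word_prod s *m v != 0;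
  nf_word : product_word B p;
  nf_gap_lt1 : r < 1;
  nf_gap : forall s, product_word B s ->
    (exists u k, cyclic_perm p u /\ s = word_power u k) \/
    (forall z, eigenvalue (complexify (word_prod s)) z -> modulus z <= r);
  nf_leading : has_unique_simple_leading_eigenvalue (word_prod p);
  nf_eigen1 : exists2 z, eigenvalue (complexify (word_prod p)) z & modulus z = 1;
  nf_eigen_le1 : forall z, eigenvalue (complexify (word_prod p)) z -> modulus z <= 1
}.

Definition extremal B (f : 'cV[R]_n.+1 -> R) : Prop :=
  (forall i x, f (B i *m x) <= f x) /\ (forall x, exists i, f (B i *m x) = f x).

Definition orbit_norm B (u : 'rV[R]_n.+1) (x : 'cV[R]_n.+1) : R :=
  sup [set `|(u *m word_prod s *m x) 0 0| | s in word_over B].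

Context {B : 'I_m -> 'M[R]_n.+1} {p : seq 'M[R]_n.+1} {r : R}.
Context (nf : normalized_family B p r).

Lemma word_over_p : word_over B p.
Proof. by case: (nf_word nf). Qed.

Lemma word_prod_nonneg s : word_over B s -> nonneg_mx (word_prod s).
Proof.
elim: s => [|a s IH] hs; first exact: nonneg_mx1.
apply: nonneg_mxM; last by apply: IH => b bs; apply: hs; rewrite in_cons bs orbT.
by have /codomP[i ->] := hs a (mem_head _ _); exact: (nf_nonneg nf).
Qed.

Lemma word_eigenvalue_le1 s : product_word B s ->
  forall z, eigenvalue (complexify (word_prod s)) z -> modulus z <= 1.
Proof.
move=> hs z; case: (nf_gap nf hs) => [[u [k [[i ->] sE]]]|h /h zr]; last first.
  by rewrite (le_trans zr)// ltW// (nf_gap_lt1 nf).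
case: k sE => [|k] sE; first by case: hs; rewrite sE.
rewrite sE -(expr1n _ k.+1).
exact/eigenvalue_rot_power_le/(nf_eigen_le1 nf).
Qed.

Lemma word_diag_le1 s k : word_over B s -> word_prod s k k <= 1.
Proof.
case: s => [_|a s hs]; first by rewrite mxE eqxx.
apply: nonneg_diag_le1; first exact: word_prod_nonneg.
by apply: word_eigenvalue_le1; split.
Qed.

Lemma word_prod_bounded : exists2 C, 0 < C &
  forall s, word_over B s -> `|word_prod s| <= C.
Proof.
have pos (jk : 'I_n.+1 * 'I_n.+1) :
    exists s, word_over B s /\ 0 < word_prod s jk.1 jk.2.
  case: jk => j k /=.
  have [||s hs] := @nf_irreducible _ _ _ nf (delta_mx 0 j) (delta_mx k 0).
  - by apply/eqP => /matrixP/(_ 0 j)/eqP; rewrite !mxE !eqxx oner_eq0.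
  - by apply/eqP => /matrixP/(_ k 0)/eqP; rewrite !mxE !eqxx oner_eq0.
  rewrite -rowE -colE => h; exists s; split => //.
  rewrite lt_def word_prod_nonneg// andbT; apply: contraNneq h => h.
  by apply/eqP/matrixP => a b; rewrite !mxE.
have [T HT] := choice pos.
(* The sum over the finitely many pairs dominates each reciprocal, and the [1] makes the bound
   positive. *)
exists (1 + \sum_jk (word_prod (T jk) jk.1 jk.2)^-1) => [|s hs].
  rewrite ltr_wpDr// sumr_ge0// => jk _; rewrite invr_ge0 ltW//.
  by case: (HT jk).
have sum0 (P : pred ('I_n.+1 * 'I_n.+1)) :
    0 <= \sum_(jk | P jk) (word_prod (T jk) jk.1 jk.2)^-1.
  by apply: sumr_ge0 => jk _; rewrite invr_ge0 ltW//; case: (HT jk).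
apply: norm_leP => [|k j]; first by rewrite addr_ge0.
have [hT Tpos] := HT (j, k).
rewrite ger0_norm; last exact: word_prod_nonneg.
apply: (@le_trans _ _ (word_prod (T (j, k)) j k)^-1); last first.
  rewrite (bigD1 (j, k))//= addrCA lerDl addr_ge0//.
rewrite -[leRHS]mul1r ler_pdivlMr//.
apply: le_trans (word_diag_le1 k (word_over_cat hs hT)).
rewrite word_prod_cat mxE (bigD1 j)//= lerDl sumr_ge0// => i _.
by rewrite mulr_ge0//; apply: word_prod_nonneg.
Qed.

Lemma orbit_norm_ub u x s : word_over B s ->
  `|(u *m word_prod s *m x) 0 0| <= orbit_norm B u x.
Proof.
move=> hs; apply: sup_upper_bound; last by exists s.
split; first by exists `|(u *m word_prod s *m x) 0 0|, s.
have [C C0 HC] := word_prod_bounded.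
exists (n.+1%:R * (n.+1%:R * `|u| * C) * `|x|) => _ [t ht <-].
rewrite (le_trans (entry_le_norm _ _ _))// (le_trans (norm_mulmx _ _))//.
rewrite ler_wpM2r// ler_wpM2l//.
by rewrite (le_trans (norm_mulmx _ _))// ler_wpM2l ?mulr_ge0// HC.
Qed.

Lemma orbit_norm_le u x (c : R) :
  (forall s, word_over B s -> `|(u *m word_prod s *m x) 0 0| <= c) ->
  orbit_norm B u x <= c.
Proof.
move=> h; apply: ge_sup => [|_ [s hs <-]]; last exact: h.
by exists `|(u *m word_prod [::] *m x) 0 0|, [::].
Qed.

Lemma orbit_norm_is_norm u : u != 0 -> is_norm (orbit_norm B u).
Proof.
move=> u0; split.
- move=> x y; apply: orbit_norm_le => s hs.
  rewrite mulmxDr mxE (le_trans (ler_normD _ _))// lerD//; exact: orbit_norm_ub.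
- have scale_le (a : R) x : orbit_norm B u (a *: x) <= `|a| * orbit_norm B u x.
    apply: orbit_norm_le => s hs.
    by rewrite -scalemxAr mxE normrM ler_wpM2l// orbit_norm_ub.
  move=> a x; apply/eqP; rewrite eq_le scale_le /=.
  have [->|a0] := eqVneq a 0.
    rewrite normr0 mul0r scale0r.
    by rewrite (le_trans _ (@orbit_norm_ub u 0 [::] _)).
  rewrite -ler_pdivlMl ?normr_gt0//.
  have := scale_le a^-1 (a *: x).
  by rewrite scalerA mulVf// scale1r normfV.
- move=> x x0; apply: contrapT => /eqP xn0.
  have [s hs /eqP] := nf_irreducible nf u0 xn0; apply.
  apply/matrixP => i j; rewrite !ord1 [RHS]mxE; apply/eqP.
  by rewrite -normr_eq0 eq_le normr_ge0 andbT -x0 orbit_norm_ub.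
Qed.

(** A nonempty word ends in some letter [B j], so its value at [x] is at most the orbit norm at
    [B j *m x]. Only the empty word escapes this, and [u p = u] replaces it by the nonempty word
    [p]. *)
Lemma orbit_norm_extremal u : u *m word_prod p = u -> extremal B (orbit_norm B u).
Proof.
move=> up; have F1 i x : orbit_norm B u (B i *m x) <= orbit_norm B u x.
  apply: orbit_norm_le => s hs.
  have := orbit_norm_ub u x (word_over_cat hs (@word_over1 B i)).
  by rewrite word_prod_cat /= mulmx1 !mulmxA.
split=> // x.
have [i0] : exists i : 'I_m, True.
  case: (nf_word nf); case: p => [//|a q] _ /(_ a (mem_head _ _)) /codomP[i _].
  by exists i.
move=> _; pose i := [arg max_(i > i0) orbit_norm B u (B i *m x)]%O.
exists i; apply/eqP; rewrite eq_le F1 /=.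
have imax j : orbit_norm B u (B j *m x) <= orbit_norm B u (B i *m x).
  by rewrite /i; case: arg_maxP => // k _; apply.
have nonempty s : product_word B s ->
    `|(u *m word_prod s *m x) 0 0| <= orbit_norm B u (B i *m x).
  case; case/lastP: s => [//|s a] _ hs.
  have /codomP[j aE] : a \in codom B by apply: hs; rewrite mem_rcons mem_head.
  rewrite -cats1 word_prod_cat /= mulmx1 -!mulmxA mulmxA aE.
  apply: le_trans (imax j); apply: orbit_norm_ub => b bs.
  by apply: hs; rewrite mem_rcons in_cons bs orbT.
apply: orbit_norm_le => -[|a s] hs; last exact: nonempty.
have := nonempty p (nf_word nf).
by rewrite up mulmx1.
Qed.

End ExtremalNorm.

(** * Uniqueness of the extremal norm *)

Section Uniqueness.
Context {R : realType} {m n : nat}.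
Context {B : 'I_m -> 'M[R]_n.+1} {p : seq 'M[R]_n.+1} {r : R}.
Context (nf : normalized_family B p r).
Context {u : 'rV[R]_n.+1} {v : 'cV[R]_n.+1}.
Context (up : u *m word_prod p = u) (pv : word_prod p *m v = v) (uv : u *m v = 1%:M).
Context (van : vanishing (fun k => `|(word_prod p - v *m u) ^+ k|)).
Context {f : 'cV[R]_n.+1 -> R} (fN : is_norm f) (fE : extremal B f).

Let T : 'M[R]_n.+1 := word_prod p - v *m u.

(** [v u] is idempotent and both its products with [T] vanish. The exponent must be positive: at [0]
    the right-hand side would be [v u + 1]. *)
Lemma projection_power k : word_prod p ^+ k.+1 = v *m u + T ^+ k.+1.
Proof.
have uT : u *m T = 0 by rewrite /T mulmxBr up mulmxA uv mul1mx subrr.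
have Tv : T *m v = 0 by rewrite /T mulmxBl pv -mulmxA uv mulmx1 subrr.
elim: k => [|k IH]; first by rewrite !expr1 /T addrC subrK.
have pE : word_prod p = v *m u + T by rewrite /T addrC subrK.
rewrite [LHS]exprS IH {1}pE -mulmxE mulmxDl !mulmxDr.
have -> : v *m u *m (v *m u) = v *m u.
  by rewrite mulmxA -[v *m u *m v]mulmxA uv mulmx1.
have -> : v *m u *m T ^+ k.+1 = 0.
  by rewrite exprS -mulmxE mulmxA -[v *m u *m T]mulmxA uT mulmx0 mul0mx.
have -> : T *m (v *m u) = 0 by rewrite mulmxA Tv mul0mx.
by rewrite addr0 add0r mulmxE -exprS.
Qed.

Lemma extremal_word s x : word_over B s -> f (word_prod s *m x) <= f x.
Proof.
elim: s x => [|a s IH] x hs; first by rewrite mul1mx.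
have /codomP[i ->] := hs a (mem_head _ _).
rewrite /= -mulmxA (le_trans (fE.1 _ _))// IH// => b bs.
by apply: hs; rewrite in_cons bs orbT.
Qed.

Lemma projection_power_apply k y :
  word_prod p ^+ k.+1 *m y = (u *m y) 0 0 *: v + T ^+ k.+1 *m y.
Proof.
rewrite projection_power mulmxDl; congr (_ + _).
by rewrite -mulmxA {1}[u *m y]mx11_scalar mul_mx_scalar.
Qed.

Lemma vanishing_remainder (K c : R) : 0 <= K -> 0 <= c ->
  vanishing (fun k => K * (n.+1%:R * `|T ^+ k.+1| * c)).
Proof.
move=> K0 c0; apply: vanishingZ => //.
apply: (@vanishing_le _ _ (fun k => n.+1%:R * c * `|T ^+ k.+1|)) => [k|].
  by rewrite mulrAC.
apply: vanishingZ; first by rewrite mulr_ge0.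
move=> eta /van[N HN]; exists N => k Nk; apply: HN.
by rewrite (leq_trans Nk).
Qed.

(** For [y = S x], the vectors [p^k y] tend to [(u y) v] while [f (p^k y) <= f y <= f x]. *)
Lemma extremal_ge_orbit x : orbit_norm B u x * f v <= f x.
Proof.
have v0 : v != 0.
  apply: contra_eqN uv => /eqP ->; rewrite mulmx0 eq_sym.
  by apply/eqP => /matrixP/(_ 0 0)/eqP; rewrite !mxE oner_eq0.
have fv : 0 < f v by exact: is_norm_gt0.
rewrite -ler_pdivlMr//; apply: orbit_norm_le => s hs.
rewrite ler_pdivlMr//; set y := word_prod s *m x.
rewrite -mulmxA -/y.
have [K K0 fK] := is_norm_bound fN.
have fyx : f y <= f x by exact: extremal_word.
have key k : `|(u *m y) 0 0| * f v - f x <= K * (n.+1%:R * `|T ^+ k.+1| * `|y|).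
  apply: (@le_trans _ _ (f (T ^+ k.+1 *m y))); last first.
    by rewrite (le_trans (fK _))// ler_wpM2l ?norm_mulmx// ltW.
  rewrite -(is_normZ fN) lerBlDr.
  have -> : (u *m y) 0 0 *: v = - (T ^+ k.+1 *m y) + word_prod p ^+ k.+1 *m y.
    by rewrite projection_power_apply addrCA addNr addr0.
  rewrite (le_trans (is_normD fN _ _))// is_normN// lerD2l.
  rewrite -word_prod_power (le_trans _ fyx)// extremal_word//.
  exact/word_over_power/(word_over_p nf).
rewrite leNgt -subr_gt0; apply/negP => h.
exact: (vanishing_not_ge h (vanishing_remainder (ltW K0) (normr_ge0 y))).
Qed.

(* [w a k] is the word read along the trajectory between times [a] and [a + k]. *)
Lemma extremal_trajectory x : exists w : nat -> nat -> seq 'M[R]_n.+1,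
  [/\ forall a k, word_over B (w a k),
      forall a k, size (w a k) = k,
      forall k, f (word_prod (w 0 k) *m x) = f x &
      forall a k, word_prod (w 0 (a + k)%N) = word_prod (w a k) *m word_prod (w 0 a)]%N.
Proof.
have [next Hnext] := choice fE.2.
(* Matrices act from the left, so the first letter met along the trajectory stands last in the
   word. *)
pose fix w y k := if k is k'.+1 then rcons (w (B (next y) *m y) k') (B (next y)) else [::].
pose it a := iter a (fun y => B (next y) *m y) x.
have wS y k : word_prod (w y k.+1) = word_prod (w (B (next y) *m y) k) *m B (next y).
  by rewrite /= -cats1 word_prod_cat /= mulmx1.
exists (fun a k => w (it a) k); split.
- move=> a k; elim: k (it a) => [//|k IH] y b.
  by rewrite mem_rcons in_cons => /orP[/eqP ->|/IH//]; exact: codom_f.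
- by move=> a k; elim: k (it a) => [//|k IH] y /=; rewrite size_rcons IH.
- move=> k; rewrite [it 0]/=; elim: k x @it => [|k IH] y _; first by rewrite mul1mx.
  by rewrite wS -mulmxA IH Hnext.
move=> a k.
have main y : word_prod (w y (a + k)%N) =
    word_prod (w (iter a (fun y => B (next y) *m y) y) k) *m word_prod (w y a).
  elim: a y => [|a IH] y; first by rewrite mulmx1.
  by rewrite addSn !wS IH iterSr mulmxA.
exact: main.
Qed.

Lemma extremal_le_orbit x : f x <= orbit_norm B u x * f v.
Proof.
have [C C0 HC] := word_prod_bounded nf.
have [K K0 fK] := is_norm_bound fN.
have F0 : 0 <= orbit_norm B u x.
  by rewrite (le_trans _ (@orbit_norm_ub _ _ _ _ _ _ nf u x [::] _)).
have [fx0|fx0] := leP (f x) 0.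
  by rewrite (le_trans fx0)// mulr_ge0// is_norm_ge0.
have [w [wB sw fw wD]] := extremal_trajectory x.
pose X k := word_prod (w 0%N k) *m x.
have XC k : `|X k| <= n.+1%:R * C * `|x|.
  by rewrite (le_trans (norm_mulmx _ _))// ler_wpM2r// ler_wpM2l// HC.
have [y Hy] := bounded_cluster XC.
(* From [f x = f (X k) <= K * |X k|], all points [X k] have norm at least [f x / K], so they cannot
   cluster at [0]. *)
have y0 : 0 < `|y|.
  rewrite normr_gt0; apply/eqP => y0.
  have [k _] := Hy (f x / K) 0%N (divr_gt0 fx0 K0).
  by rewrite y0 subr0 ltr_pdivlMr// mulrC ltNge -(fw k) fK.
have [L L0 HL] := @fixed_gap R n r C (nf_gap_lt1 nf).
(* For a return product [Q] the error [Q y - y] is [Q (y - X a)] plus [X (a + k) - y]; the two terms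
   of [D] account for them. Since [L * D * delta = |y|], an error below [D * delta] contradicts
   [fixed_gap]. *)
pose D := n.+1%:R * C + 1.
have D0 : 0 < D by rewrite ltr_wpDl// mulr_ge0// ltW.
pose delta := `|y| / (L * D).
have delta0 : 0 < delta by rewrite divr_gt0// mulr_gt0.
have [a _ Ha] := Hy delta 0%N delta0.
have recur k : `|X (a + k)%N - y| < delta ->
    exists i j, w a k = word_power (rot i p) j.
  move=> Hk; case: k Hk => [|k] Hk.
    by exists 0%N, 0%N; apply: size0nil; rewrite sw.
  have pw : product_word B (w a k.+1).
    by split; [move=> w0; have := sw a k.+1; rewrite w0 | exact: wB].
  have [[_ [j [[i ->] ->]]]|noteig] := nf_gap nf pw; first by exists i, j.
  exfalso; have := HL _ y (HC _ (wB a k.+1)) noteig.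
  apply/negP; rewrite -ltNge; set Q := word_prod _.
  have -> : Q *m y - y = Q *m (y - X a) + (X (a + k.+1)%N - y).
    by rewrite mulmxBr /X wD -mulmxA addrA subrK.
  have lt1 : `|Q *m (y - X a) + (X (a + k.+1)%N - y)| < D * delta.
    rewrite (le_lt_trans (ler_normD _ _))// /D mulrDl mul1r ler_ltD//.
    rewrite (le_trans (norm_mulmx _ _))// ler_pM ?mulr_ge0//.
      by rewrite ler_wpM2l// HC.
    by rewrite distrC ltW.
  rewrite -(ltr_pM2l L0) in lt1; rewrite (lt_le_trans lt1)//.
  by rewrite /delta mulrA mulrC divfK// gt_eqF// mulr_gt0.
rewrite leNgt -subr_gt0; apply/negP => h.
(* Bounds the vector [z] below whatever the rotation and the return time, so [N] can be fixed before
   the return is chosen. *)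
pose c := n.+1%:R * C * (n.+1%:R * C * `|x|).
have c0 : 0 <= c by rewrite !mulr_ge0// ltW.
have [N HN] := vanishing_remainder (ltW K0) c0 h.
(* Of the copies of [p] read until time [b], the rotation splits one between the two ends and
   [projection_power] takes one for its positive exponent; [N.+3] leaves at least [N] others. *)
have [b ab Hb] := Hy delta (a + N.+3 * size p)%N delta0.
pose k := (b - a)%N.
have leab : (a <= b)%N := leq_trans (leq_addr _ _) ab.
have bE : b = (a + k)%N by rewrite subnKC.
rewrite bE in Hb; have [i [j wE]] := recur k Hb.
have kE : k = (j * size p)%N by rewrite -(sw a k) wE size_word_power size_rot.
have sp : (0 < size p)%N.
  by case: (nf_word nf) => /eqP; rewrite -size_eq0 lt0n.
have jN : (N.+3 <= j)%N by rewrite -(leq_pmul2r sp) -kE leq_subRL.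
case: j => [//|[//|j]] in wE kE jN *.
have takeB : word_over B (take i p).
  by move=> q /mem_take; exact: (word_over_p nf).
have dropB : word_over B (drop i p).
  by move=> q /mem_drop; exact: (word_over_p nf).
(* The return word is [drop i p], a power of [p], then [take i p]. The last part is absorbed into
   [z], the first does not increase [f], and [z] is still a product applied to [x], so [|u z|] is at
   most the orbit norm. *)
pose z := word_prod (take i p) *m X a.
have fz : f x <= f (word_prod p ^+ j.+1 *m z).
  rewrite -(fw (a + k)%N) wD wE word_prod_rot_power -!mulmxA /z /X.
  exact: extremal_word.
have zc : `|z| <= c.
  by rewrite (le_trans (norm_mulmx _ _))// ler_pM ?mulr_ge0// ler_wpM2l// HC.
have uz : `|(u *m z) 0 0| <= orbit_norm B u x.
  rewrite /z /X mulmxA [_ *m X a]mulmxA -[u *m _ *m _]mulmxA -word_prod_cat.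
  by apply: (orbit_norm_ub nf); exact: word_over_cat.
have Nj : (N <= j)%N := @ltnW N j jN.
have := HN j Nj; rewrite ltNge => /negP; apply.
rewrite lerBlDr addrC (le_trans fz)// projection_power_apply.
rewrite (le_trans (is_normD fN _ _))// lerD//.
  by rewrite is_normZ// ler_wpM2r// is_norm_ge0.
rewrite (le_trans (fK _))//; apply: (ler_wpM2l (ltW K0)).
by rewrite (le_trans (norm_mulmx _ _))// ler_wpM2l// mulr_ge0.
Qed.

Lemma extremal_orbitE x : f x = f v * orbit_norm B u x.
Proof.
by apply/eqP; rewrite eq_le mulrC extremal_le_orbit extremal_ge_orbit.
Qed.

End Uniqueness.

Theorem normalized_extremal_norm (R : realType) (m n : nat)
    (B : 'I_m -> 'M[R]_n.+1) p r : normalized_family B p r ->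
  exists u : 'rV[R]_n.+1,
    [/\ is_norm (orbit_norm B u), extremal B (orbit_norm B u) &
        forall f, is_norm f -> extremal B f ->
          exists2 c, 0 < c & forall x, f x = c * orbit_norm B u x].
Proof.
move=> nf; have [C C0 HC] := word_prod_bounded nf.
have wp := word_over_p nf.
have [||u [v [up pv uv van]]] := @leading_projection _ _ (word_prod p) C
  (word_prod_nonneg nf wp) (nf_leading nf) (nf_eigen1 nf).
- exact: (nf_eigen_le1 nf).
- by move=> k; rewrite -word_prod_power; exact/HC/word_over_power.
have n10 : (1%:M : 'M[R]_1) != 0.
  by apply/eqP => /matrixP/(_ 0 0)/eqP; rewrite !mxE oner_eq0.
have u0 : u != 0 by apply: contraNneq n10 => u0; rewrite -uv u0 mul0mx.
have v0 : v != 0 by apply: contraNneq n10 => v0; rewrite -uv v0 mulmx0.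
exists u; split; [exact: (orbit_norm_is_norm nf)|exact: (orbit_norm_extremal nf)|].
move=> f fN fE; exists (f v); first exact: is_norm_gt0.
by move=> x; exact: (extremal_orbitE nf up pv uv van fN fE).
Qed.

(** * Transposition *)

Section Transposition.
Context {R : realType} {n : nat}.
Implicit Types (M : 'M[R]_n) (s t p : seq 'M[R]_n).

Definition word_tr s := rev (map trmx s).

Lemma word_trK : involutive word_tr.
Proof.
move=> s; rewrite /word_tr map_rev revK -map_comp -[RHS]map_id.
by apply: eq_map => M /=; rewrite trmxK.
Qed.

Lemma word_tr_cat s t : word_tr (s ++ t) = word_tr t ++ word_tr s.
Proof. by rewrite /word_tr map_cat rev_cat. Qed.

Lemma size_word_tr s : size (word_tr s) = size s.
Proof. by rewrite size_rev size_map. Qed.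

Lemma word_prod_tr s : word_prod (word_tr s) = (word_prod s)^T.
Proof.
elim: s => [|a s IH]; first by rewrite trmx1.
by rewrite -cat1s word_tr_cat word_prod_cat IH /= mulmx1 trmx_mul.
Qed.

Lemma word_power_rcons s k : word_power s k ++ s = s ++ word_power s k.
Proof.
elim: k => [|k IH]; first by rewrite cats0.
by rewrite /word_power /= -/(word_power s k) -catA IH.
Qed.

Lemma word_tr_power s k : word_tr (word_power s k) = word_power (word_tr s) k.
Proof.
elim: k => [//|k IH]; rewrite /word_power /= -/(word_power s k) word_tr_cat IH.
exact: word_power_rcons.
Qed.

Lemma word_tr_rot i p : cyclic_perm (word_tr p) (word_tr (rot i p)).
Proof.
have pE : word_tr p = word_tr (drop i p) ++ word_tr (take i p).
  by rewrite -word_tr_cat cat_take_drop.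
by exists (size (word_tr (drop i p))); rewrite pE rot_size_cat /rot word_tr_cat.
Qed.

Lemma char_poly_trmx (K : comNzRingType) k (M : 'M[K]_k) : char_poly M^T = char_poly M.
Proof.
rewrite /char_poly -det_tr; congr (\det _).
by apply/matrixP => i j; rewrite !mxE eq_sym.
Qed.

Lemma eigenvalue_trmx M z :
  eigenvalue (complexify M^T) z = eigenvalue (complexify M) z.
Proof.
by rewrite !eigenvalue_root_char /complexify -map_trmx char_poly_trmx.
Qed.

Lemma unique_simple_leading_trmx M : has_unique_simple_leading_eigenvalue M ->
  has_unique_simple_leading_eigenvalue M^T.
Proof.
move=> [z [[ez lez] simple uniq]]; exists z; split.
- by split=> [|y]; rewrite eigenvalue_trmx//; exact: lez.
- by rewrite /complexify -map_trmx char_poly_trmx.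
- by move=> y; rewrite eigenvalue_trmx; exact: uniq.
Qed.

End Transposition.

Lemma word_over_tr (R : realType) (m n : nat) (B : 'I_m -> 'M[R]_n.+1) s :
  word_over (fun i => (B i)^T) s -> word_over B (word_tr s).
Proof.
move=> hs a; rewrite mem_rev => /mapP[b /hs /codomP[i ->] ->].
by rewrite trmxK codom_f.
Qed.

Lemma word_over_trV (R : realType) (m n : nat) (B : 'I_m -> 'M[R]_n.+1) s :
  word_over B s -> word_over (fun i => (B i)^T) (word_tr s).
Proof.
by move=> hs a; rewrite mem_rev => /mapP[b /hs /codomP[i ->] ->]; exact: codom_f.
Qed.

(** Each clause is symmetric: transposition keeps spectra, reverses words, sends rotations to
    rotations, and exchanges [y] and [v] in the coefficient form of irreducibility. *)
Lemma normalized_family_tr (R : realType) (m n : nat) (B : 'I_m -> 'M[R]_n.+1) p r :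
  normalized_family B p r ->
  normalized_family (fun i => (B i)^T) (word_tr p) r.
Proof.
move=> nf; have pB := word_over_p nf.
have tr0 (k l : nat) (M : 'M[R]_(k, l)) : M != 0 -> M^T != 0.
  by apply: contraNneq => /(congr1 trmx); rewrite trmxK trmx0 => ->.
split.
- by move=> i j k; rewrite mxE; exact: (nf_nonneg nf).
- move=> y v y0 v0.
  have [s hs h] := nf_irreducible nf (tr0 _ _ _ v0) (tr0 _ _ _ y0).
  exists (word_tr s); first exact: word_over_trV.
  by rewrite word_prod_tr -[y]trmxK -[v]trmxK -!trmx_mul mulmxA; exact: tr0.
- split; last exact: word_over_trV.
  case: (nf_word nf) => p0 _ /(congr1 size); rewrite size_word_tr => /size0nil.
  exact: p0.
- exact: (nf_gap_lt1 nf).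
- move=> s [s0 hs].
  have ps : product_word B (word_tr s).
    split; last exact: word_over_tr.
    by move=> /(congr1 size); rewrite size_word_tr => /size0nil.
  have [[_ [k [[i ->] sE]]]|h] := nf_gap nf ps; [left|right].
    exists (word_tr (rot i p)), k; split; first exact: word_tr_rot.
    by rewrite -[s]word_trK sE word_tr_power.
  by move=> z; rewrite -[s]word_trK word_prod_tr eigenvalue_trmx; exact: h.
- by rewrite word_prod_tr; exact/unique_simple_leading_trmx/(nf_leading nf).
- have [z ez z1] := nf_eigen1 nf; exists z; last exact: z1.
  by rewrite word_prod_tr eigenvalue_trmx.
- by move=> z; rewrite word_prod_tr eigenvalue_trmx; exact: (nf_eigen_le1 nf).
Qed.

(** * Convex sets *)

Section Convexity.
Context {R : realType} {n : nat}.
Implicit Types (C D : set 'cV[R]_n) (x y z : 'cV[R]_n).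

Definition dotv y x : R := (y^T *m x) 0 0.

Lemma dotvE y x : dotv y x = \sum_i y i 0 * x i 0.
Proof. by rewrite /dotv mxE; apply: eq_bigr => i _; rewrite mxE. Qed.

Lemma dotvC y x : dotv y x = dotv x y.
Proof. by rewrite !dotvE; apply: eq_bigr => i _; rewrite mulrC. Qed.

Lemma dotvDr y x z : dotv y (x + z) = dotv y x + dotv y z.
Proof. by rewrite /dotv mulmxDr mxE. Qed.

Lemma dotvZr y (a : R) x : dotv y (a *: x) = a * dotv y x.
Proof. by rewrite /dotv -scalemxAr mxE. Qed.

Lemma dotvNr y x : dotv y (- x) = - dotv y x.
Proof. by rewrite -scaleN1r dotvZr mulN1r. Qed.

Lemma dotv0r y : dotv y 0 = 0.
Proof. by rewrite /dotv mulmx0 mxE. Qed.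

Lemma dotvDl y x z : dotv (x + z) y = dotv x y + dotv z y.
Proof. by rewrite !(dotvC _ y) dotvDr. Qed.

Lemma dotvZl y (a : R) x : dotv (a *: x) y = a * dotv x y.
Proof. by rewrite !(dotvC _ y) dotvZr. Qed.

Lemma dotvNl y x : dotv (- x) y = - dotv x y.
Proof. by rewrite !(dotvC _ y) dotvNr. Qed.

Lemma dotv_mul (M : 'M[R]_n) y x : dotv y (M *m x) = dotv (M^T *m y) x.
Proof. by rewrite /dotv trmx_mul trmxK mulmxA. Qed.

Lemma dotv_gt0 x : x != 0 -> 0 < dotv x x.
Proof.
move=> /cV0Pn[i xi]; rewrite dotvE (bigD1 i)//= ltr_pwDl//.
  by rewrite -expr2 exprn_even_gt0.
by apply: sumr_ge0 => j _; rewrite -expr2 sqr_ge0.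
Qed.

Lemma dotv_le_norm y x : dotv y x <= n%:R * `|y| * `|x|.
Proof.
rewrite /dotv (le_trans (ler_norm _))// (le_trans (entry_le_norm _ _ _))//.
rewrite (le_trans (norm_mulmx _ _))//.
suff -> : `|y^T| = `|y| by [].
by rewrite -[in RHS](trmxK y) norm_trmx.
Qed.

Lemma dotv_continuous y : continuous (dotv y).
Proof.
apply: (@lipschitz_continuous _ _ R^o _ (n%:R * `|y|)) => x z.
rewrite -dotvNr -dotvDr ler_norml dotv_le_norm andbT lerNl -dotvNr.
by rewrite (le_trans (dotv_le_norm _ _))// normrN.
Qed.

Lemma convex_setP C : @convex_set R 'cV[R]_n C <->
  forall x y (t : R), 0 <= t <= 1 -> C x -> C y -> C (t *: x + (1 - t) *: y).
Proof.
split=> [cC x y t /andP[t0 t1] Cx Cy|cC x y t].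
  have := cC x y (Itv01 t0 t1); rewrite !inE => /(_ Cx Cy); exact.
rewrite !inE => Cx Cy; apply: cC => //.
by apply/andP; split; [exact: ge0|exact: le1].
Qed.

Lemma convex_halfspace y (c : R) : @convex_set R 'cV[R]_n [set x | dotv y x <= c].
Proof.
apply/convex_setP => x z t /andP[t0 t1] /= xc zc.
rewrite dotvDr !dotvZr; have -> : c = t * c + (1 - t) * c by ring.
by rewrite lerD// ler_wpM2l// subr_ge0.
Qed.

Lemma scale_setP (c : R) C x : c != 0 -> scale_set c C x <-> C (c^-1 *: x).
Proof.
move=> c0; split=> [[z Cz <-]|Cx]; first by rewrite scalerA mulVf// scale1r.
by exists (c^-1 *: x) => //; rewrite scalerA divff// scale1r.
Qed.

Lemma convex_scale (c : R) C : @convex_set R 'cV[R]_n C ->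
  @convex_set R 'cV[R]_n (scale_set c C).
Proof.
move=> /convex_setP cC; apply/convex_setP => _ _ t t01 [x Cx <-] [y Cy <-].
exists (t *: x + (1 - t) *: y); first exact: cC.
by rewrite scalerDr !scalerA ![c * _]mulrC.
Qed.

Lemma continuous_sumr (T : topologicalType) (I : Type) (l : seq I) (f : I -> T -> R) :
  (forall i, continuous (f i)) -> continuous (fun t => \sum_(i <- l) f i t).
Proof.
move=> fc; elim: l => [|i l IH] t.
  by under eq_fun do rewrite big_nil; exact: cvg_cst.
under eq_fun do rewrite big_cons.
by apply: cvgD; [exact: fc|exact: IH].
Qed.

Lemma entry_continuous (i : 'I_n) : continuous (fun x : 'cV[R]_n => x i 0).
Proof.
apply: (@lipschitz_continuous _ _ R^o _ 1) => x y; rewrite mul1r.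
by have := entry_le_norm (x - y) i 0; rewrite !mxE.
Qed.

(* The normal direction at the point of [C] nearest to [x] separates. *)
Lemma separation C x : compact C -> @convex_set R 'cV[R]_n C -> C !=set0 -> ~ C x ->
  exists y, exists2 c, (forall z, C z -> dotv y z <= c) & c < dotv y x.
Proof.
move=> Cc /convex_setP Cv C0 Cx.
pose phi z := dotv (z - x) (z - x).
have phic : continuous phi.
  rewrite (_ : phi = fun z => \sum_i (z i 0 - x i 0) * (z i 0 - x i 0)); last first.
    by apply/funext => z; rewrite /phi dotvE; apply: eq_bigr => i _; rewrite !mxE.
  have ec i : continuous (fun z : 'cV[R]_n => z i 0 - x i 0).
    by move=> z; apply: continuousB; [exact: entry_continuous|exact: cst_continuous].
  by apply: continuous_sumr => i z; exact: (cvgM (ec i z) (ec i z)).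
have [z0] := compact_EVT_min C0 Cc (continuous_subspaceT phic).
rewrite inE => Cz0 z0min.
pose y := x - z0.
have y0 : y != 0.
  by rewrite subr_eq0; apply/eqP => xz; apply: Cx; rewrite xz.
exists y, (dotv y z0); last first.
  by rewrite -subr_gt0 -dotvNr -dotvDr dotv_gt0.
move=> z Cz; rewrite -subr_le0 -dotvNr -dotvDr leNgt; apply/negP => h.
set w := z - z0 in h; set b := dotv y w in h; pose a := dotv w w.
have a0 : 0 < a.
  by apply: dotv_gt0; apply: contraTneq h => w0; rewrite /b w0 dotv0r ltxx.
(* Minimality of [z0] along the segment towards [z]: expand [|t w - y|^2 >= |y|^2]. *)
have step t : 0 <= t <= 1 -> 2 * b * t <= a * (t * t).
  move=> t01; have := z0min (t *: z + (1 - t) *: z0).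
  rewrite inE => /(_ (Cv _ _ _ t01 Cz Cz0)).
  have -> : t *: z + (1 - t) *: z0 = x + (t *: w - y).
    apply/matrixP => i j; rewrite /w /y !mxE; ring.
  have subxK e : x + e - x = e by rewrite addrC addKr.
  rewrite /phi subxK.
  have -> : z0 - x = - y by rewrite /y opprB.
  rewrite /a /b /w /y !(dotvDl, dotvDr, dotvNl, dotvNr, dotvZl, dotvZr).
  rewrite (dotvC z0 x) (dotvC z x) (dotvC z0 z); lra.
(* Then [t * a <= b], so [step] would give [2 b t <= b t] although [b t > 0]. *)
pose t := Num.min 1 (b / a).
have t0 : 0 < t by rewrite lt_min ltr01 divr_gt0.
have t1 : t <= 1 by rewrite ge_min lexx.
have ta : t * a <= b by rewrite -ler_pdivlMr// ge_min lexx orbT.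
have := step t; rewrite (ltW t0) t1 => /(_ isT).
nra.
Qed.

(** The segments joining [C] to [D] form the hull, and they are a continuous image of [[0, 1] * C *
    D]. This supplies the compactness that [separation] requires and that a hull defined as an
    intersection does not show. *)
Lemma convex_hull2 C D : compact C -> compact D ->
  @convex_set R 'cV[R]_n C -> @convex_set R 'cV[R]_n D -> C !=set0 -> D !=set0 ->
  exists E, [/\ compact E, @convex_set R 'cV[R]_n E, C `<=` E, D `<=` E &
    forall F, @convex_set R 'cV[R]_n F -> C `<=` F -> D `<=` F -> E `<=` F].
Proof.
move=> Cc Dc /convex_setP Cv /convex_setP Dv [c0 Cc0] [d0 Dd0].
pose g (q : R * ('cV[R]_n * 'cV[R]_n)) := q.1 *: q.2.1 + (1 - q.1) *: q.2.2.
pose P := `[(0 : R), (1 : R)]%classic `*` (C `*` D).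
have PE t x y : P (t, (x, y)) <-> [/\ 0 <= t <= 1, C x & D y].
  by rewrite /P /= in_itv /=; split=> [[? [? ?]]|[? ? ?]].
exists (g @` P); split.
- apply: continuous_compact; last first.
    apply: compact_setX; first exact: segment_compact.
    exact: compact_setX.
  have c1 : continuous (fun q : R * ('cV[R]_n * 'cV[R]_n) => q.1).
    by move=> q; exact: cvg_fst.
  have c2 : continuous (fun q : R * ('cV[R]_n * 'cV[R]_n) => q.2).
    by move=> q; exact: cvg_snd.
  have c21 : continuous (fun q : R * ('cV[R]_n * 'cV[R]_n) => q.2.1).
    by move=> q; apply: (continuous_comp (c2 q)); exact: cvg_fst.
  have c22 : continuous (fun q : R * ('cV[R]_n * 'cV[R]_n) => q.2.2).
    by move=> q; apply: (continuous_comp (c2 q)); exact: cvg_snd.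
  have c1' : continuous (fun q : R * ('cV[R]_n * 'cV[R]_n) => 1 - q.1).
    by move=> q; apply: (@continuousB _ R^o _ (cst 1)); [exact: cst_continuous|exact: c1].
  apply: continuous_subspaceT => q.
  by apply: cvgD; [exact: (cvgZ (c1 q) (c21 q))|exact: (cvgZ (c1' q) (c22 q))].
(* A combination of four points is regrouped into one point of [C] and one of [D]; if both weights
   of a group vanish, any point of the set serves. *)
- have mix (F : set 'cV[R]_n) (a b : R) x y :
      (forall x y t, 0 <= t <= 1 -> F x -> F y -> F (t *: x + (1 - t) *: y)) ->
      0 <= a -> 0 <= b -> F x -> F y ->
      exists2 z, F z & a *: x + b *: y = (a + b) *: z.
    move=> Fv a0 b0 Fx Fy; have [ab|ab] := eqVneq (a + b) 0.
      have -> : a = 0 by lra.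
      have -> : b = 0 by lra.
      by exists x => //; rewrite !scale0r !addr0 scale0r.
    have ab0 : 0 < a + b by rewrite lt_def ab addr_ge0.
    exists ((a / (a + b)) *: x + (1 - a / (a + b)) *: y).
      apply: Fv => //; rewrite divr_ge0 ?addr_ge0//= ler_pdivrMr// mul1r lerDl//.
    rewrite scalerDr !scalerA; congr (_ *: _ + _ *: _); field => //.
  apply/convex_setP => _ _ s /andP[s0 s1] [[t [x y]] /PE[/andP[t0 t1] Cx Dy] <-]
    [[t' [x' y']] /PE[/andP[t'0 t'1] Cx' Dy'] <-].
  have s1' : 0 <= 1 - s by rewrite subr_ge0.
  have t1s : 0 <= 1 - t by rewrite subr_ge0.
  have t1s' : 0 <= 1 - t' by rewrite subr_ge0.
  have [cz Ccz czE] := mix C _ _ _ _ Cv (mulr_ge0 s0 t0) (mulr_ge0 s1' t'0) Cx Cx'.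
  have [dz Ddz dzE] := mix D _ _ _ _ Dv (mulr_ge0 s0 t1s) (mulr_ge0 s1' t1s') Dy Dy'.
  exists (s * t + (1 - s) * t', (cz, dz)).
    apply/PE; split=> //; apply/andP; split; nra.
  rewrite /g /= -czE.
  have -> : 1 - (s * t + (1 - s) * t') = s * (1 - t) + (1 - s) * (1 - t') by ring.
  rewrite -dzE !scalerDr !scalerA.
  by rewrite addrACA.
- move=> x Cx; exists (1, (x, d0)); first by apply/PE; split=> //; rewrite ler01 lexx.
  by rewrite /g /= subrr scale0r scale1r addr0.
- move=> x Dx; exists (0, (c0, x)); first by apply/PE; split=> //; rewrite ler01 lexx.
  by rewrite /g /= subr0 scale0r scale1r add0r.
- move=> F /convex_setP Fv CF DF _ [[t [x y]] /PE[t01 /CF Fx /DF Fy] <-].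
  exact: Fv.
Qed.

Lemma finite_convex_hull (I : eqType) (l : seq I) (K : I -> set 'cV[R]_n) :
  l != [::] -> (forall i, compact (K i)) ->
  (forall i, @convex_set R 'cV[R]_n (K i)) -> (forall i, K i !=set0) ->
  exists E, [/\ compact E, @convex_set R 'cV[R]_n E, (forall i, i \in l -> K i `<=` E) &
    forall F, @convex_set R 'cV[R]_n F -> (forall i, i \in l -> K i `<=` F) -> E `<=` F].
Proof.
move=> + Kc Kv K0; elim: l => [//|i l IH] _.
have [->|l0] := eqVneq l [::].
  exists (K i); split=> // [j|F _]; first by rewrite inE => /eqP ->.
  by apply; rewrite mem_head.
have [E [Ec Ev EK Emin]] := IH l0.
have E0 : E !=set0.
  case: l l0 {IH} EK Emin => [//|j l] _ EK _; have [x Kx] := K0 j.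
  by exists x; apply: (EK j) => //; rewrite mem_head.
have [E' [E'c E'v KE' EE' E'min]] := convex_hull2 (Kc i) Ec (Kv i) Ev (K0 i) E0.
exists E'; split=> // [j|F Fv FK].
  rewrite in_cons => /orP[/eqP -> //|jl].
  by apply: subset_trans EE'; exact: EK.
apply: E'min => //; first by apply: FK; rewrite mem_head.
by apply: Emin => // j jl; apply: FK; rewrite in_cons jl orbT.
Qed.

Lemma convex_hull_compact m (K : 'I_m -> set 'cV[R]_n) : (0 < m)%N ->
  (forall i, compact (K i)) ->
  (forall i, @convex_set R 'cV[R]_n (K i)) -> (forall i, K i !=set0) ->
  [/\ compact (convex_hull (\bigcup_i K i)),
      @convex_set R 'cV[R]_n (convex_hull (\bigcup_i K i)) &
      forall i, K i `<=` convex_hull (\bigcup_i K i)].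
Proof.
move=> m0 Kc Kv K0.
have [|E [Ec Ev EK Emin]] := @finite_convex_hull 'I_m (enum 'I_m) K _ Kc Kv K0.
  by rewrite -size_eq0 -cardE card_ord -lt0n.
suff -> : convex_hull (\bigcup_i K i) = E.
  by split=> // i; apply: EK; rewrite mem_enum.
apply/seteqP; split.
  apply: smallest_sub => // x [i _]; apply: EK; exact: mem_enum.
move=> x Ex F /= [Fv KF]; apply: Emin Ex => // i _ y Ky.
by apply: KF; exists i.
Qed.

End Convexity.

(** * Invariant bodies and support functions *)

Lemma finite_max (R : realType) (I : finType) (i0 : I) (F : I -> R) :
  exists i, forall j, F j <= F i.
Proof. by exists [arg max_(i > i0) F i]%O; case: arg_maxP => // i _ h j; apply: h. Qed.

Section InvariantBody.
Context {R : realType} {m n : nat}.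
Implicit Types (A : 'I_m -> 'M[R]_n.+1) (F : 'cV[R]_n.+1 -> R) (G H : set 'cV[R]_n.+1).

Definition extremal_for A (rho : R) F : Prop :=
  (forall i x, F (A i *m x) <= rho * F x) /\
  (forall x, exists i, F (A i *m x) = rho * F x).

(** For a norm [F], the unit ball of the dual norm. *)
Definition dual_body F : set 'cV[R]_n.+1 := [set x | forall y, dotv y x <= F y].

Definition support_function H (y : 'cV[R]_n.+1) : R := sup [set dotv y x | x in H].

Lemma is_norm_ge_norm F : is_norm F -> exists2 c, 0 < c & forall x, c * `|x| <= F x.
Proof.
move=> FN; have [K K0 FK] := is_norm_bound FN.
have Fc : continuous F.
  apply: (@lipschitz_continuous _ _ R^o _ K) => x y.
  rewrite ler_norml; apply/andP; split.
    rewrite lerNl opprB (le_trans (is_normB FN _ _))// (le_trans (FK _))//.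
    by rewrite distrC.
  by rewrite (le_trans (is_normB FN _ _)).
pose sphere := [set x : 'cV[R]_n.+1 | `|x| <= 1] `&` [set x | `|x| = 1].
have Sc : compact sphere.
  apply: compact_closedI; first exact: closed_ball_cV_compact.
  rewrite (_ : mkset _ = (@Num.norm _ 'cV[R]_n.+1) @^-1` [set y : R | y = 1])//.
  apply: closed_comp; last exact: closed_eq.
  by move=> x _; exact: norm_continuous.
have scaled x : x != 0 -> sphere (`|x|^-1 *: x).
  move=> x0; suff h : `| `|x|^-1 *: x| = 1 by split=> //=; rewrite h.
  by rewrite normrZ normfV normr_id mulVf// normr_eq0.
have S0 : sphere !=set0.
  exists (`|const_mx 1 : 'cV[R]_n.+1|^-1 *: const_mx 1); apply: scaled.
  by apply/eqP => /matrixP/(_ 0 0)/eqP; rewrite !mxE oner_eq0.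
have [z zS zmin] := compact_EVT_min S0 Sc (continuous_subspaceT Fc).
have z0 : z != 0.
  move: zS; rewrite inE => -[_ /= z1]; apply/eqP => z0.
  by move: z1; rewrite z0 normr0 => /eqP; rewrite eq_sym oner_eq0.
exists (F z); first exact: is_norm_gt0.
move=> x; have [->|x0] := eqVneq x 0; first by rewrite normr0 mulr0 is_norm0.
have := zmin (`|x|^-1 *: x); rewrite inE => /(_ (scaled x x0)).
rewrite is_normZ// normfV normr_id mulrC ler_pdivlMr ?normr_gt0//.
Qed.

Lemma dual_body_convex_body F : is_norm F -> convex_body (dual_body F).
Proof.
move=> FN; have bodyE : dual_body F = \bigcap_y [set x | dotv y x <= F y].
  by apply/seteqP; split=> [x h y _|x h y]; exact: h.
split.
- apply/convex_setP => x z t t01 xG zG y.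
  have /convex_setP Hv := @convex_halfspace R n.+1 y (F y).
  exact: (Hv x z t t01 (xG y) (zG y)).
- have [K K0 FK] := is_norm_bound FN.
  apply: (@subclosed_compact _ _ [set x | `|x| <= K]).
  + rewrite bodyE; apply: closed_bigI => y _.
    apply: (@closed_comp _ _ (dotv y) [set c : R | c <= F y]); last exact: closed_le.
    by move=> x _; exact: dotv_continuous.
  + exact: closed_ball_cV_compact.
  + move=> x xG /=; apply: norm_leP => [|i j]; first exact: ltW.
    have bnd (y : 'cV[R]_n.+1) : `|y| <= 1 -> dotv y x <= K.
      move=> y1; rewrite (le_trans (xG y))// (le_trans (FK y))//.
      by rewrite -[leRHS]mulr1 ler_wpM2l// ltW.
    have d1 : `|delta_mx i 0 : 'cV[R]_n.+1| <= 1.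
      apply: norm_leP => // a b; rewrite mxE.
      by case: (_ && _); rewrite ?normr1 ?normr0.
    have dE : dotv (delta_mx i 0) x = x i j.
      by rewrite /dotv trmx_delta -rowE mxE !ord1.
    rewrite ler_norml lerNl -dE bnd// andbT -dotvNl bnd//.
    by rewrite normrN.
- have [c c0 cF] := is_norm_ge_norm FN.
  exists 0; rewrite /interior; apply/nbhs_ballP.
  (* The division compensates the dimension factor in [dotv_le_norm], which comes from the max-entry
     norm. *)
  exists (c / n.+1%:R); first by rewrite /= divr_gt0.
  move=> x; rewrite -ball_normE /= sub0r normrN => xc y.
  rewrite (le_trans (dotv_le_norm _ _))// (le_trans _ (cF y))//.
  rewrite mulrAC ler_wpM2r//.
  by rewrite mulrC -ler_pdivlMr ?ltr0Sn// ltW.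
- by move=> x xG y; rewrite dotvNr -dotvNl (le_trans (xG _))// is_normN.
Qed.

Section Support.
Context {H : set 'cV[R]_n.+1} (HB : convex_body H).

Lemma convex_body0 : H 0.
Proof.
case: HB => /convex_setP Hv _ [x /interior_subset Hx] Hs.
have := Hv _ _ (1 / 2) _ Hx (Hs _ Hx).
rewrite (_ : 1 - 1 / 2 = 1 / 2 :> R); last by field.
by rewrite scalerN subrr; apply; apply/andP; split; lra.
Qed.

Lemma support_function_ub y x : H x -> dotv y x <= support_function H y.
Proof.
move=> Hx; apply: sup_upper_bound; last by exists x.
split; first by exists (dotv y x), x.
case: HB => _ /compact_bounded/pinfty_ex_gt0[M M0 HM] _ _.
exists (n.+1%:R * `|y| * M) => _ [z Hz <-].
rewrite (le_trans (dotv_le_norm _ _))// ler_wpM2l ?mulr_ge0//.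
exact: HM.
Qed.

Lemma support_function_le y c : (forall x, H x -> dotv y x <= c) ->
  support_function H y <= c.
Proof.
move=> h; apply: ge_sup => [|_ [x Hx <-]]; last exact: h.
by exists (dotv y 0), 0 => //; exact: convex_body0.
Qed.

Lemma support_function_is_norm : is_norm (support_function H).
Proof.
case: (HB) => _ _ Hint Hs; split.
- move=> x y; apply: support_function_le => z Hz.
  by rewrite dotvDl lerD// support_function_ub.
- have scale_le (a : R) x : support_function H (a *: x) <= `|a| * support_function H x.
    apply: support_function_le => z Hz; rewrite dotvZl.
    have [a0|a0] := leP 0 a; first by rewrite ger0_norm// ler_wpM2l// support_function_ub.
    have -> : a * dotv x z = - a * dotv x (- z) by rewrite dotvNr mulrNN.
    rewrite ltr0_norm//; apply: ler_wpM2l; first by rewrite oppr_ge0 ltW.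
    exact/support_function_ub/Hs.
  move=> a x; apply/eqP; rewrite eq_le scale_le /=.
  have [->|a0] := eqVneq a 0.
    rewrite normr0 mul0r (le_trans _ (@support_function_ub _ 0 convex_body0))//.
    by rewrite dotv0r.
  rewrite -ler_pdivlMl ?normr_gt0//.
  have := scale_le a^-1 (a *: x).
  by rewrite scalerA mulVf// scale1r normfV.
(* A ball around an interior point [x0] contains [x0 + t y] and [x0 - t y]. Testing [y] on the first
   and on the opposite of the second, and adding, gives [2 t (y . y) <= 0]. *)
- move=> y hy; apply/eqP; rewrite -[_ == _]negbK; apply/negP => y0.
  case: Hint => x0; rewrite /interior => /nbhs_ballP[e /= e0 eH].
  have ny0 : 0 < `|y| by rewrite normr_gt0.
  pose t := e / 2 / `|y|.
  have t0 : 0 < t by rewrite !divr_gt0.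
  have Hball s : `|s| = t -> H (x0 + s *: y).
    move=> st; apply: eH; rewrite -ball_normE /=.
    rewrite opprD addrA subrr sub0r normrN normrZ st /t divfK ?gt_eqF//.
    by rewrite ltr_pdivrMr// ltr_pMr// ltr1n.
  have h1 := support_function_ub y (Hball t (gtr0_norm t0)).
  have h2 := support_function_ub y (Hs _ (Hball (- t) (etrans (normrN t) (gtr0_norm t0)))).
  have d0 := mulr_gt0 t0 (dotv_gt0 y0).
  move: h1 h2; rewrite hy dotvNr !dotvDr !dotvZr; lra.
Qed.

End Support.

(** At [y], the hull of the [A i H] has support function the maximum over [i] of that of [H] at
    [(A i)^T *m y], while [rho H] has [rho] times that of [H]. *)
Lemma support_function_extremal A rho H : 0 < rho -> (0 < m)%N -> convex_body H ->
  convex_hull (\bigcup_i [set A i *m x | x in H]) = scale_set rho H ->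
  extremal_for (fun i => (A i)^T) rho (support_function H).
Proof.
move=> rho0 m0 HB hullE; split.
  move=> i y; apply: support_function_le => // x Hx.
  rewrite -dotv_mul.
  have : scale_set rho H (A i *m x).
    by rewrite -hullE => C /= [_ HC]; apply: HC; exists i => //; exists x.
  by move=> [z Hz <-]; rewrite dotvZr ler_pM2l// support_function_ub.
move=> y; have [i imax] := finite_max (Ordinal m0) (fun i => support_function H ((A i)^T *m y)).
exists i; apply/eqP; rewrite eq_le; apply/andP; split.
  apply: support_function_le => // x Hx; rewrite -dotv_mul.
  have : scale_set rho H (A i *m x).
    by rewrite -hullE => C /= [_ HC]; apply: HC; exists i => //; exists x.
  by move=> [z Hz <-]; rewrite dotvZr ler_pM2l// support_function_ub.
rewrite -ler_pdivlMl//; apply: support_function_le => // x Hx.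
rewrite ler_pdivlMl// -dotvZr.
have : convex_hull (\bigcup_i [set A i *m x | x in H]) (rho *: x).
  by rewrite hullE; exists x.
move=> h; apply: (h [set z | dotv y z <= support_function H ((A i)^T *m y)]).
split; first exact: convex_halfspace.
move=> _ [j _ [z Hz <-]] /=; rewrite dotv_mul (le_trans _ (imax j))//.
exact: support_function_ub.
Qed.

(** By separation, a convex body is the intersection of its supporting half-spaces, hence determined
    by its support function. *)
Lemma scale_dual_body F (c : R) H : 0 < c -> convex_body H ->
  (forall y, support_function H y = c * F y) -> H = scale_set c (dual_body F).
Proof.
move=> c0 HB HF; have cn0 : c != 0 by rewrite gt_eqF.
apply/seteqP; split=> x.
  move=> Hx; apply/scale_setP => // y; rewrite dotvZr ler_pdivrMl// -HF.
  exact: support_function_ub.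
move=> /scale_setP-/(_ cn0) xG; apply: contrapT => Hx.
case: (HB) => Hv Hc _ _.
have [|y [b Hb]] := separation Hc Hv _ Hx; first by exists 0; exact: convex_body0.
apply/negP; rewrite -leNgt.
have := xG y; rewrite dotvZr ler_pdivrMl// -HF => h.
by rewrite (le_trans h)// support_function_le.
Qed.

(* [A]-invariant bodies correspond, through their support functions, to the
   extremal norms of the transposed family. *)
Theorem invariant_body_of_norm A rho F : 0 < rho -> (0 < m)%N -> is_norm F ->
  extremal_for (fun i => (A i)^T) rho F ->
  (forall f, is_norm f -> extremal_for (fun i => (A i)^T) rho f ->
     exists2 c, 0 < c & forall x, f x = c * F x) ->
  (forall y c, (forall x, dual_body F x -> dotv y x <= c) -> F y <= c) ->
  exists G, (convex_body G /\
      convex_hull (\bigcup_i [set A i *m x | x in G]) = scale_set rho G) /\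
    forall H, convex_body H ->
      convex_hull (\bigcup_i [set A i *m x | x in H]) = scale_set rho H ->
      exists2 c, 0 < c & H = scale_set c G.
Proof.
move=> rho0 m0 FN [Fle Feq] Funiq Fsup; have rhon0 : rho != 0 by rewrite gt_eqF.
have GB := dual_body_convex_body FN; exists (dual_body F); split.
  split=> //; case: (GB) => Gv Gc _ _.
  have AG i x : dual_body F x -> scale_set rho (dual_body F) (A i *m x).
    move=> Gx; apply/scale_setP => // y; rewrite dotvZr ler_pdivrMl// dotv_mul.
    exact: le_trans (Gx _) (Fle _ _).
  pose K i := [set A i *m x | x in dual_body F].
  have [|||Cc Cv KC] := @convex_hull_compact R n.+1 m K m0.
  - move=> i; apply: continuous_compact => //; apply: continuous_subspaceT.
    apply: (@lipschitz_continuous _ _ _ _ (n.+1%:R * `|A i|)) => x y.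
    by rewrite -mulmxBr norm_mulmx.
  - move=> i; apply/convex_setP => _ _ t t01 [x Gx <-] [y Gy <-].
    exists (t *: x + (1 - t) *: y).
      by move: Gv => /convex_setP; apply.
    by rewrite mulmxDr -!scalemxAr.
  - by move=> i; exists (A i *m 0), 0 => //; exact: convex_body0.
  apply/seteqP; split.
    apply: smallest_sub; first exact: convex_scale.
    by move=> _ [i _ [x Gx <-]]; exact: AG.
  move=> x /scale_setP-/(_ rhon0) Gx; apply: contrapT => Cx.
  have [|y [c Cyc]] := separation Cc Cv _ Cx.
    by exists (A (Ordinal m0) *m 0); apply: (KC (Ordinal m0)); exists 0 => //; exact: convex_body0.
  apply/negP; rewrite -leNgt.
  (* For [i] extremal at [y], [rho * F y = F ((A i)^T *m y)]. The functional [y] is at most [c] on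
     [A i G], so [Fsup] bounds this by [c], against the separation. *)
  have [i Fi] := Feq y.
  have := Gx y; rewrite dotvZr ler_pdivrMl// -Fi => h; rewrite (le_trans h)//.
  apply: Fsup => z Gz; rewrite -dotv_mul; apply: Cyc; apply: (KC i).
  by exists z.
move=> H HB hullE.
have [c c0 HF] := Funiq _ (support_function_is_norm HB)
  (support_function_extremal rho0 m0 HB hullE).
by exists c => //; exact: scale_dual_body.
Qed.

End InvariantBody.

(** * Irreducibility, spectral radii and rescaling *)

(** The [x] with [y S x = 0] for all products [S] form an invariant subspace, proper because the
    empty word gives [y x = 0]. By irreducibility it is zero and cannot contain [v]. *)
Lemma irreducible_coefficients (R : realType) (m n : nat) (A : 'I_m -> 'M[R]_n.+1)
    (y : 'rV[R]_n.+1) (v : 'cV[R]_n.+1) :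
  irreducible_family A -> y != 0 -> v != 0 ->
  exists2 s, word_over A s & y *m word_prod s *m v != 0.
Proof.
move=> Airr y0 v0; apply: contrapT => /forall2NP none.
pose null (x : 'cV[R]_n.+1) := forall s, word_over A s -> y *m word_prod s *m x = 0.
have null_v : null v.
  by move=> s hs; case: (none s) => // /negP; rewrite negbK => /eqP.
(* A subspace of null vectors of maximal dimension contains every null vector. *)
pose P k := `[< exists U : {vspace 'cV[R]_n.+1}, (forall x, x \in U -> null x) /\ \dim U = k >].
have exP : exists k, P k.
  exists 0%N; apply/asboolP; exists 0%VS; split; last exact: dimv0.
  by move=> x; rewrite memv0 => /eqP -> s _; rewrite mulmx0.
have ubP k : P k -> (k <= \dim {:'cV[R]_n.+1})%N.
  by move=> /asboolP[U [_ <-]]; exact/dimvS/subvf.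
case: (ex_maxnP exP ubP) => k /asboolP[U [Unull dimU]] kmax.
have inU x : null x -> x \in U.
  move=> xnull; suff /eqP -> : U == (U + <[x]>)%VS.
    by apply: (subvP (addvSr _ _)); exact: memv_line.
  rewrite eqEdim addvSl dimU; apply: kmax; apply/asboolP.
  exists (U + <[x]>)%VS; split=> // _ /memv_addP[a aU [_ /vlineP[c ->] ->]] s hs.
  by rewrite mulmxDr -scalemxAr (Unull a)// (xnull s)// scaler0 addr0.
have [|U0|Uf] := Airr U.
- move=> i x xU; apply: inU => s hs.
  have := Unull x xU (s ++ [:: A i]) (word_over_cat hs (@word_over1 _ _ _ A i)).
  by rewrite word_prod_cat /= mulmx1 !mulmxA.
- by have := inU v null_v; rewrite U0 memv0 (negbTE v0).
- move/negP: y0; apply; apply/eqP/rowP => j; rewrite mxE.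
  have := Unull (delta_mx j 0); rewrite Uf memvf => /(_ isT [::]).
  rewrite mulmx1 -colE => /(_ _)/matrixP/(_ 0 0); rewrite !mxE; exact.
Qed.

Section Spectral.
Context {R : realType} {n : nat}.
Implicit Types (S : 'M[R]_n.+1).

Lemma spectral_radius_ub S z : eigenvalue (complexify S) z ->
  modulus z <= spectral_radius S.
Proof.
move=> ez; apply: sup_upper_bound; last by exists z.
split; first by exists (modulus z), z.
have [s [_ es]] := char_poly_roots (complexify S).
exists (\sum_(w <- s) modulus w) => _ [w /= ew <-].
have ws : w \in s by rewrite es.
rewrite (big_rem w ws) /= lerDl sumr_ge0// => x _; exact: modulus_ge0.
Qed.

Lemma spectral_radius_leading S z : leading_eigenvalue S z ->
  spectral_radius S = modulus z.
Proof.
move=> [ez lez]; apply/eqP; rewrite eq_le spectral_radius_ub// andbT.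
apply: ge_sup => [|_ [w /= ew <-]]; last exact: lez.
by exists (modulus z), z.
Qed.

Lemma spectral_radius_ge0 S : 0 <= spectral_radius S.
Proof.
have [s [Hs es]] := char_poly_roots (complexify S).
case: s Hs es => [|z s] Hs es.
  by have := size_char_poly (complexify S); rewrite Hs big_nil size_poly1.
by apply: le_trans (modulus_ge0 z) (spectral_radius_ub _); rewrite -es mem_head.
Qed.

(** [X - c M = c (X / c - M)]: substitute [X / c]. Carrying the whole list of roots preserves
    multiplicities, hence simplicity. *)
Lemma char_poly_scale (K : fieldType) (M : 'M[K]_n.+1) (c : K) (s : seq K) : c != 0 ->
  char_poly M = \prod_(z <- s) ('X - z%:P) ->
  char_poly (c *: M) = \prod_(z <- s) ('X - (c * z)%:P).
Proof.
move=> c0 Hs.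
have szs : size s = n.+1.
  by have := size_char_poly M; rewrite Hs size_prod_XsubC => -[].
have E : char_poly_mx (c *: M) =
    c%:P *: map_mx (comp_poly (c^-1 *: 'X)) (char_poly_mx M).
  apply/matrixP => i j; rewrite !mxE raddfB /= comp_polyC.
  rewrite raddfMn /= comp_polyX mulrBr mulrnAr mul_polyC scalerA mulfV// scale1r.
  by rewrite polyCM.
rewrite /char_poly E detZ det_map_mx -/(char_poly M) Hs rmorph_prod /=.
rewrite -szs; elim: (s) => [|z l IH]; first by rewrite !big_nil expr0 mulr1.
rewrite !big_cons exprS mulrACA IH; congr (_ * _).
rewrite raddfB /= comp_polyX comp_polyC mulrBr mul_polyC scalerA mulfV//.
by rewrite scale1r polyCM.
Qed.

Lemma unique_simple_leading_scale S (c : R) : 0 < c ->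
  has_unique_simple_leading_eigenvalue S ->
  has_unique_simple_leading_eigenvalue (c *: S).
Proof.
move=> c0 [z [[ez lez] simple uniq]]; have cn0 : c != 0 by rewrite gt_eqF.
have cC0 : c%:C%C != 0 :> R[i] by rewrite fmorph_eq0.
have [s [Hs es]] := char_poly_roots (complexify S).
have HcS : char_poly (complexify (c *: S)) = \prod_(z <- s) ('X - (c%:C%C * z)%:P).
  by rewrite /complexify map_mxZ; exact: char_poly_scale.
have ecS w : eigenvalue (complexify (c *: S)) w -> exists2 y,
    eigenvalue (complexify S) y & w = c%:C%C * y.
  move=> /(eigenvalue_scale cn0) ew; exists (c^-1%:C%C * w); first exact: ew.
  by rewrite mulrA -rmorphM mulfV// mul1r.
have modc w : modulus (c%:C%C * w) = c * modulus w.
  by rewrite modulusM modulus_real gtr0_norm.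
have ez' := eigenvalue_scaleV c ez.
exists (c%:C%C * z); split.
- split; first exact: ez'.
  move=> w /ecS[y ey ->]; rewrite !modc ler_pM2l//; exact: lez.
- rewrite HcS -(big_map _ predT (fun w => 'X - w%:P)) mu_prod_XsubC count_map.
  move: simple; rewrite Hs mu_prod_XsubC => <-; apply: eq_count => w /=.
  by apply/eqP/eqP => [/(mulfI cC0)|->].
- move=> w /ecS[y ey ->] yz yzc; rewrite !modc ltr_pM2l//; apply: uniq => //.
    by apply: contraNneq yz => ->.
  apply: contraNneq yzc => ->.
  by apply/eqP; rewrite rmorphM; congr (_ * _); apply: esym; exact: conjc_real.
Qed.

End Spectral.

Section Scaling.
Context {R : realType} {m n : nat}.
Implicit Types (A : 'I_m -> 'M[R]_n.+1) (s p : seq 'M[R]_n.+1).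

Definition scale_word (c : R) s := map ( *:%R c) s.

Lemma scale_wordK (c : R) : c != 0 -> cancel (scale_word c^-1) (scale_word c).
Proof.
move=> c0 s; rewrite /scale_word -map_comp -[RHS]map_id; apply: eq_map => M /=.
by rewrite scalerA divff// scale1r.
Qed.

Lemma word_prod_scale (c : R) s : word_prod (scale_word c s) = c ^+ size s *: word_prod s.
Proof.
elim: s => [|M s IH]; first by rewrite expr0 scale1r.
by rewrite /= IH -scalemxAl -scalemxAr scalerA exprS.
Qed.

Lemma scale_word_power (c : R) s k :
  scale_word c (word_power s k) = word_power (scale_word c s) k.
Proof. by elim: k => [//|k IH]; rewrite /word_power /= /scale_word map_cat; congr (_ ++ _). Qed.

Lemma word_over_scale A (c : R) s :
  word_over A s -> word_over (fun i => c *: A i) (scale_word c s).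
Proof.
move=> hs M /mapP[N /hs/codomP[i ->] ->]; exact: (codom_f (fun i => c *: A i)).
Qed.

Lemma product_word_scale A (c : R) s :
  product_word A s -> product_word (fun i => c *: A i) (scale_word c s).
Proof. by case=> s0 hs; split; [case: s s0 {hs}|exact: word_over_scale]. Qed.

Lemma product_word_unscale A (c : R) s : c != 0 ->
  product_word (fun i => c^-1 *: A i) s -> product_word A (scale_word c s).
Proof.
move=> c0 hs; have := product_word_scale c hs.
rewrite (_ : (fun i => _) = A)//; apply/funext => i.
by rewrite scalerA divff// scale1r.
Qed.

Lemma nu_power s : s <> [::] -> nu s ^+ size s = spectral_radius (word_prod s).
Proof.
move=> s0; have sz : (size s)%:R != 0 :> R.
  by rewrite pnatr_eq0 size_eq0; apply/eqP.
rewrite -powR_mulrn ?powR_ge0// -powRrM mulVf// powRr1//.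
exact: spectral_radius_ge0.
Qed.

(** Raising to the power [size s] turns the length-dependent factor [(1 - eps)^(1/|s|)] into the
    fixed factor [1 - eps], the uniform gap that [fixed_gap] consumes. *)
Lemma dominant_gap A p (q eps : R) : 0 <= q -> 0 < eps < 1 ->
  (forall s, product_word A s ->
    ~ (exists w u k, [/\ [set p] w, cyclic_perm w u & s = word_power u k]) ->
    nu s <= (1 - eps) `^ (size s)%:R^-1 * q) ->
  forall s, product_word A s ->
    (exists u k, cyclic_perm p u /\ s = word_power u k) \/
    spectral_radius (word_prod s) <= (1 - eps) * q ^+ size s.
Proof.
move=> q0 /andP[eps0 eps1] gap s hs.
have [|no] := pselect (exists u k, cyclic_perm p u /\ s = word_power u k); first by left.
right; have s0 := hs.1.
have := gap s hs; rewrite -nu_power//.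
have e0 : 0 <= 1 - eps by rewrite subr_ge0 ltW.
have -> : (1 - eps) * q ^+ size s = ((1 - eps) `^ (size s)%:R^-1 * q) ^+ size s.
  rewrite exprMn; congr (_ * _).
  rewrite -powR_mulrn ?powR_ge0// -powRrM mulVf ?powRr1//.
  by rewrite pnatr_eq0 size_eq0; apply/eqP.
move=> h; rewrite lerXn2r ?nnegrE ?powR_ge0 ?mulr_ge0 ?powR_ge0//.
by apply: h => -[_ [u [k [-> up sE]]]]; apply: no; exists u, k.
Qed.

Lemma normalized_family_scale A p (q eps : R) : irreducible_family A ->
  (forall i j k, 0 <= A i j k) -> 0 < q -> 0 < eps < 1 -> product_word A p ->
  (forall s, product_word A s ->
    (exists u k, cyclic_perm p u /\ s = word_power u k) \/
    spectral_radius (word_prod s) <= (1 - eps) * q ^+ size s) ->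
  spectral_radius (word_prod p) = q ^+ size p ->
  has_unique_simple_leading_eigenvalue (word_prod p) ->
  normalized_family (fun i => q^-1 *: A i) (scale_word q^-1 p) (1 - eps).
Proof.
move=> Airr A0 q0 /andP[eps0 eps1] pA gap pq lead.
have qn0 : q != 0 by rewrite gt_eqF.
have iq0 : 0 < q^-1 by rewrite invr_gt0.
have eig_scale s z : eigenvalue (complexify (word_prod s)) z ->
    q ^+ size s * modulus z <= spectral_radius (word_prod (scale_word q s)).
  move=> ez; rewrite -[q ^+ _]gtr0_norm ?exprn_gt0// -modulus_real -modulusM.
  apply: spectral_radius_ub.
  by rewrite word_prod_scale; exact: eigenvalue_scaleV.
split.
- by move=> i j k; rewrite mxE mulr_ge0// ltW.
- move=> y v y0 v0; have [s hs h] := irreducible_coefficients Airr y0 v0.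
  exists (scale_word q^-1 s); first exact: word_over_scale.
  by rewrite word_prod_scale -scalemxAr -scalemxAl scaler_eq0 negb_or h andbT expf_neq0 ?invr_eq0.
- exact: product_word_scale.
- by rewrite ltrBlDr ltrDl.
- move=> s hs; have := gap _ (product_word_unscale qn0 hs).
  move=> [[_ [k [[i ->] sE]]]|h]; [left|right].
    exists (rot i (scale_word q^-1 p)), k; split; first by exists i.
    rewrite -map_rot -/(scale_word _ _) -scale_word_power -sE.
    by have := scale_wordK (invr_neq0 qn0) s; rewrite invrK => ->.
  move=> z /eig_scale ez; have := le_trans ez h.
  by rewrite size_map mulrC ler_pM2r// exprn_gt0.
- rewrite word_prod_scale; apply: unique_simple_leading_scale => //.
  by rewrite exprn_gt0.
- have [z [lz _ _]] := lead; exists ((q^-1 ^+ size p)%:C%C * z).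
    by rewrite word_prod_scale; exact: eigenvalue_scaleV lz.1.
  rewrite exprVn.
  rewrite modulusM modulus_real gtr0_norm ?invr_gt0 ?exprn_gt0//.
  by rewrite -(spectral_radius_leading lz) pq mulVf// expf_neq0.
- move=> z /eig_scale; rewrite scale_wordK// pq size_map.
  by rewrite -[leRHS]mulr1 ler_pM2l// exprn_gt0.
Qed.

(** Here every nonempty product has only the eigenvalue [0]. A positive entry of some [A i], closed
    into a cycle by a word from irreducibility, would give a product with a positive diagonal
    entry. *)
Lemma dominant_zero A p : irreducible_family A -> (forall i j k, 0 <= A i j k) ->
  (forall s, product_word A s ->
    (exists u k, cyclic_perm p u /\ s = word_power u k) \/
    spectral_radius (word_prod s) <= 0) ->
  spectral_radius (word_prod p) = 0 -> (forall i, A i = 0) /\ n = 0%N.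
Proof.
move=> Airr A0 gap p0.
have word0 s : product_word A s ->
    forall z, eigenvalue (complexify (word_prod s)) z -> modulus z <= 0.
  move=> hs z ez; case: (gap s hs) => [[_ [k [[i ->] sE]]]|h]; last first.
    exact: le_trans (spectral_radius_ub ez) h.
  case: k sE => [|k] sE; first by case: hs; rewrite sE.
  rewrite sE in ez; have p_le0 w : eigenvalue (complexify (word_prod p)) w -> modulus w <= 0.
    by move=> /spectral_radius_ub; rewrite p0.
  by have := eigenvalue_rot_power_le (ltn0Sn k) p_le0 ez; rewrite expr0n.
have nonneg s : word_over A s -> nonneg_mx (word_prod s).
  elim: s => [|a s IH] hs; first exact: nonneg_mx1.
  apply: nonneg_mxM; last by apply: IH => b bs; apply: hs; rewrite in_cons bs orbT.
  by have /codomP[i ->] := hs a (mem_head _ _); exact: A0.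
have delta_neq0 k (i : 'I_k.+1) : (delta_mx 0 i : 'rV[R]_k.+1) != 0.
  by apply/eqP => /matrixP/(_ 0 i)/eqP; rewrite !mxE !eqxx oner_eq0.
have delta_neq0' k (i : 'I_k.+1) : (delta_mx i 0 : 'cV[R]_k.+1) != 0.
  by apply/eqP => /matrixP/(_ i 0)/eqP; rewrite !mxE !eqxx oner_eq0.
have Az i : A i = 0.
  apply/matrixP => j k; rewrite [RHS]mxE; apply/eqP; rewrite eq_le A0 andbT leNgt.
  apply/negP => pos.
  have [s hs] := irreducible_coefficients Airr (delta_neq0 _ k) (delta_neq0' _ j).
  rewrite -rowE -colE => h.
  have sk : 0 < word_prod s k j.
    rewrite lt_def nonneg// andbT; apply: contraNneq h => h.
    by apply/eqP/matrixP => a b; rewrite !mxE.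
  have ws : word_over A (A i :: s).
    move=> b; rewrite in_cons => /orP[/eqP ->|/hs//]; exact: codom_f.
  pose M := word_prod (A i :: s).
  have M0 : nonneg_mx M by exact: nonneg.
  have a0 : 0 < M j j.
    rewrite /M /= mxE (bigD1 k)//= ltr_pwDl ?mulr_gt0// sumr_ge0// => l _.
    by rewrite mulr_ge0 ?A0// nonneg.
  (* This scaling makes the diagonal entry [2] and keeps all eigenvalues [0], against
     [nonneg_diag_le1]. *)
  have c0 : 0 < 2 / M j j by rewrite divr_gt0.
  have : ((2 / M j j) *: M) j j <= 1.
    apply: nonneg_diag_le1 => [a b|z ez]; first by rewrite mxE mulr_ge0// ltW.
    have := word0 _ _ _ (eigenvalue_scale (lt0r_neq0 c0) ez).
    rewrite modulusM modulus_real gtr0_norm ?invr_gt0// pmulr_rle0 ?invr_gt0// => h2.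
    by rewrite (le_trans (h2 _))//; split.
  rewrite [X in X <= _]mxE; set a := M j j in a0 *.
  by rewrite divfK ?gt_eqF// leNgt ltr1n.
(* Only the empty word has a nonzero product, and the identity has no off-diagonal coefficient. *)
split=> //; apply/eqP; rewrite -leqn0 leqNgt; apply/negP => n0.
have [s hs] := irreducible_coefficients Airr (delta_neq0 _ ord0) (delta_neq0' _ ord_max).
move/negP; apply; apply/eqP/matrixP => a b; rewrite -rowE -colE !ord1 !mxE.
case: s hs => [|M s] hs /=.
  by rewrite mxE; case: eqP => // /(congr1 val) /= n0'; rewrite -n0' in n0.
have /codomP[i ->] := hs M (mem_head _ _).
by rewrite Az mul0mx mxE.
Qed.

End Scaling.

(** * The joint spectral radius and the conclusion *)

Lemma powR_invn_cvg (R : realType) (c : R) : 0 < c ->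
  c `^ (n.+1%:R^-1) @[n --> \oo] --> (1 : R).
Proof.
move=> c0.
have -> : (fun n => c `^ (n.+1%:R^-1)) = (fun n => expR (n.+1%:R^-1 * ln c)).
  by apply/funext => n; rewrite /powR gt_eqF.
have h : n.+1%:R^-1 * ln c @[n --> \oo] --> (0 : R).
  rewrite -(mul0r (ln c)).
  by apply: cvgM; [exact: cvg_harmonic|exact: cvg_cst].
by have := cvg_comp _ _ h (@continuous_expR R 0); rewrite expR0.
Qed.

Lemma joint_spectral_radiusE (R : realType) (d m : nat) (A : 'I_m -> 'M[R]_d) (q c C : R) :
  0 <= q -> 0 < c -> 0 < C ->
  (forall n (s : n.-tuple 'I_m), `|word_prod [seq A i | i <- s]| <= C * q ^+ n) ->
  (forall n, exists s : n.-tuple 'I_m, c * q ^+ n <= `|word_prod [seq A i | i <- s]|) ->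
  joint_spectral_radius A = q.
Proof.
move=> q0 c0 C0 ub lb; apply: cvg_lim; first exact: Rhausdorff.
(* The shift drops the term of index [0], whose exponent is the default [0^-1 = 0]. *)
rewrite -cvg_shiftS.
have root n (x : R) : 0 <= x -> (x * q ^+ n.+1) `^ n.+1%:R^-1 = x `^ n.+1%:R^-1 * q.
  move=> x0; rewrite powRM ?exprn_ge0//; congr (_ * _).
  by rewrite -powR_mulrn// -powRrM mulfV ?pnatr_eq0// powRr1.
apply: (@squeeze_cvgr _ _ _ _ (fun n => c `^ (n.+1%:R^-1) * q) (fun n => C `^ (n.+1%:R^-1) * q)).
- near=> n; apply/andP; split=> /=.
    have [s cs] := lb n.+1; rewrite -(root _ _ (ltW c0)).
    apply: le_trans (le_bigmax _ _ s); apply: ge0_ler_powR => //.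
      by rewrite nnegrE mulr_ge0 ?exprn_ge0// ltW.
    by rewrite nnegrE.
  apply/bigmax_leP; split=> [|s _]; first by rewrite mulr_ge0 ?powR_ge0.
  rewrite -(root _ _ (ltW C0)); apply: ge0_ler_powR => //; rewrite nnegrE//.
  by rewrite mulr_ge0 ?exprn_ge0// ltW.
- rewrite -[in X in _ --> X](mul1r q).
  by apply: cvgM; [exact: powR_invn_cvg|exact: cvg_cst].
- rewrite -[in X in _ --> X](mul1r q).
  by apply: cvgM; [exact: powR_invn_cvg|exact: cvg_cst].
Unshelve. all: by end_near. Qed.

Lemma joint_spectral_radius0 (R : realType) (d m : nat) (A : 'I_m -> 'M[R]_d) :
  (forall i, A i = 0) -> joint_spectral_radius A = 0.
Proof.
move=> A0; apply: cvg_lim; first exact: Rhausdorff.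
rewrite -cvg_shiftS (_ : (fun _ => _) = fun=> 0); first exact: cvg_cst.
apply/funext => n; apply/eqP; rewrite eq_le; apply/andP; split.
  apply/bigmax_leP; split=> // s _.
  case: s => -[//|i s] /= _.
  by rewrite A0 mul0mx normr0 powR0// invr_eq0 pnatr_eq0.
by apply/bigmax_geP; left.
Qed.

Section Assembly.
Context {R : realType} {m n : nat}.
Implicit Types (A : 'I_m -> 'M[R]_n.+1).

Lemma word_over_seq A s : word_over A s -> exists t : seq 'I_m, s = [seq A i | i <- t].
Proof.
elim: s => [|M s IH] hs; first by exists [::].
have [|t ->] := IH; first by move=> N Ns; apply: hs; rewrite in_cons Ns orbT.
by have /codomP[i ->] := hs M (mem_head _ _); exists (i :: t).
Qed.

(** The upper bound is the boundedness of rescaled products. For the lower one, the extremal norm is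
    constant along a trajectory, which keeps one product of each length away from [0]. *)
Lemma normalized_joint_spectral_radius A (q : R) p r : 0 < q ->
  normalized_family (fun i => q^-1 *: A i) p r -> joint_spectral_radius A = q.
Proof.
move=> q0 nf; have qn0 : q != 0 by rewrite gt_eqF.
have qk0 k : 0 <= q ^+ k by rewrite exprn_ge0// ltW.
have [C C0 HC] := word_prod_bounded nf.
have [u [FN FE _]] := normalized_extremal_norm nf.
set B := fun i => q^-1 *: A i in nf HC FN FE.
set F := orbit_norm B u in FN FE.
have wE (t : seq 'I_m) : word_prod [seq A i | i <- t] =
    q ^+ size t *: word_prod [seq B i | i <- t].
  have -> : [seq B i | i <- t] = scale_word q^-1 [seq A i | i <- t].
    by rewrite /scale_word -map_comp.
  by rewrite word_prod_scale scalerA size_map -exprMn mulfV// expr1n scale1r.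
have [K K0 FK] := is_norm_bound FN.
pose x : 'cV[R]_n.+1 := const_mx 1.
have x0 : x != 0 by apply/eqP => /matrixP/(_ 0 0)/eqP; rewrite !mxE oner_eq0.
have D0 : 0 < K * (n.+1%:R * `|x|) by rewrite !mulr_gt0// normr_gt0.
apply: (@joint_spectral_radiusE _ _ _ _ _ (F x / (K * (n.+1%:R * `|x|))) C) => //.
- exact: ltW.
- by rewrite divr_gt0// is_norm_gt0.
- move=> k s; rewrite wE normrZ (ger0_norm (qk0 _)) size_tuple mulrC.
  rewrite ler_pM2r ?exprn_gt0//; apply: HC => _ /mapP[i _ ->].
  exact: (codom_f B).
- move=> k; have [w [wB sw fw _]] := extremal_trajectory FE x.
  have [t tE] := word_over_seq (wB 0%N k).
  have st : size t == k by rewrite -(size_map B) -tE sw.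
  exists (Tuple st); rewrite /= wE normrZ (ger0_norm (qk0 _)) (eqP st) mulrC.
  rewrite ler_pM2l ?exprn_gt0// ler_pdivrMr// -tE -(fw k).
  rewrite (le_trans (FK _))// (le_trans (ler_wpM2l (ltW K0) (norm_mulmx _ _)))//.
  by rewrite [leRHS]mulrCA ler_pM2l// [leRHS]mulrCA mulrA.
Qed.

Lemma extremal_forE A (rho : R) f : 0 < rho -> is_norm f ->
  extremal_for A rho f <-> extremal (fun i => rho^-1 *: A i) f.
Proof.
move=> rho0 fN; have fE i x : f (rho^-1 *: A i *m x) = rho^-1 * f (A i *m x).
  by rewrite -scalemxAl is_normZ// gtr0_norm// invr_gt0.
have rhon0 : rho != 0 by rewrite gt_eqF.
split=> -[h1 h2]; split.
- by move=> i x; rewrite fE ler_pdivrMl.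
- by move=> x; have [i Hi] := h2 x; exists i; rewrite fE Hi mulKf.
- by move=> i x; have := h1 i x; rewrite fE ler_pdivrMl.
- by move=> x; have [i Hi] := h2 x; exists i; rewrite -Hi fE mulVKf.
Qed.

(** The default [0] of the maximum is harmless because norms are nonnegative, and [0 < m] makes it
    attained. *)
Lemma bigmax_extremal A (rho : R) f : 0 <= rho -> (0 < m)%N -> is_norm f ->
  (forall x, \big[Num.max/0]_(i < m) f (A i *m x) = rho * f x) <->
  extremal_for A rho f.
Proof.
move=> rho0 m0 fN; have f0 i x : 0 <= f (A i *m x) by exact: is_norm_ge0.
split=> [h|[h1 h2] x].
  split=> [i x|x]; first by rewrite -h; exact: le_bigmax.
  have [i _ Hi] := eq_bigmax (Ordinal m0) predT (fun i => f (A i *m x)) isT (fun i _ => f0 i x).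
  by exists i; rewrite -h Hi.
have [i Hi] := h2 x; apply/eqP; rewrite eq_le; apply/andP; split.
  by apply/bigmax_leP; split=> // ; rewrite mulr_ge0// is_norm_ge0.
by rewrite -Hi; exact: le_bigmax.
Qed.

Theorem normalized_uniqueness A (rho : R) p r : 0 < rho -> (0 < m)%N ->
  normalized_family (fun i => rho^-1 *: A i) p r ->
  (exists G, (convex_body G /\
      convex_hull (\bigcup_i [set A i *m x | x in G]) = scale_set rho G) /\
    forall H, convex_body H ->
      convex_hull (\bigcup_i [set A i *m x | x in H]) = scale_set rho H ->
      exists2 c, 0 < c & H = scale_set c G) /\
  (exists f, [/\ is_norm f, extremal_for A rho f &
    forall g, is_norm g -> extremal_for A rho g ->
      exists2 c, 0 < c & forall x, g x = c * f x]).
Proof.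
move=> rho0 m0 nf; split; last first.
  have [u [FN FE Funiq]] := normalized_extremal_norm nf.
  exists (orbit_norm (fun i => rho^-1 *: A i) u); split=> //.
    exact/extremal_forE.
  by move=> g gN gE; apply: Funiq => //; exact/extremal_forE.
have nfT := normalized_family_tr nf.
have [u [FN FE Funiq]] := normalized_extremal_norm nfT.
have BE : (fun i => (rho^-1 *: A i)^T) = (fun i => rho^-1 *: (A i)^T).
  by apply/funext => i; rewrite linearZ.
rewrite BE in nfT FN FE Funiq; set B := fun i => _ in nfT FN FE Funiq.
apply: (@invariant_body_of_norm _ _ _ A rho (orbit_norm B u)) => //.
- exact/extremal_forE.
- by move=> f fN fE; apply: Funiq => //; exact/extremal_forE.
(* An orbit norm is by construction a supremum of linear functionals: the vectors [(u S)^T] and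
   their opposites lie in the dual body, which therefore has it as support function. *)
- move=> y c yc; apply: orbit_norm_le => s hs.
  have dE z : dotv z (u *m word_prod s)^T = (u *m word_prod s *m z) 0 0.
    by rewrite /dotv -trmx_mul mxE.
  have inG (e : R) : `|e| = 1 -> dual_body (orbit_norm B u) (e *: (u *m word_prod s)^T).
    move=> e1 z; rewrite dotvZr dE (le_trans (ler_norm _))// normrM e1 mul1r.
    exact: (orbit_norm_ub nfT).
  rewrite ler_norml lerNl; apply/andP; split.
    by have := yc _ (inG (-1) (normrN1 _)); rewrite dotvZr dE mulN1r.
  by have := yc _ (inG 1 (normr1 _)); rewrite dotvZr dE mul1r.
Qed.

End Assembly.

(** Serves the degenerate case of zero matrices on a line. There every norm is extremal for the
    identity family and every body is invariant, so uniqueness for this family makes them all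
    proportional. *)
Lemma identity_normalized_family (R : realType) (m : nat) : (0 < m)%N ->
  normalized_family (fun _ : 'I_m => 1%:M : 'M[R]_1) [:: 1%:M] 0.
Proof.
move=> m0.
have eig1 z : eigenvalue (complexify (1%:M : 'M[R]_1)) z -> z = 1.
  move=> /eigenvalueP[x xz x0]; have /rV0Pn[j xj] := x0.
  move/matrixP/(_ 0 j): xz; rewrite /complexify map_mx1 mulmx1 mxE.
  by rewrite -[LHS]mul1r => /(mulIf xj) ->.
have e1 : eigenvalue (complexify (1%:M : 'M[R]_1)) 1.
  apply/eigenvalueP; exists 1%:M; first by rewrite /complexify map_mx1 mulmx1 scale1r.
  by apply/eqP => /matrixP/(_ 0 0)/eqP; rewrite !mxE oner_eq0.
have p1 : word_prod [:: (1%:M : 'M[R]_1)] = 1%:M by rewrite /= mulmx1.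
have all1 s : {subset s <= codom (fun _ : 'I_m => 1%:M : 'M[R]_1)} ->
    s = word_power [:: 1%:M] (size s).
  elim: s => [//|M s IH] hs; have /codomP[i ->] := hs M (mem_head _ _).
  rewrite /word_power /=; congr (_ :: _); apply: IH => N Ns.
  by apply: hs; rewrite in_cons Ns orbT.
split.
- by move=> _; exact: nonneg_mx1.
- move=> y v y0 v0; exists [::] => //; rewrite mulmx1.
  have /rV0Pn[j yj] := y0; have /cV0Pn[k vk] := v0.
  apply/eqP => /matrixP/(_ 0 0)/eqP; rewrite !mxE big_ord1.
  by rewrite ord1 in yj; rewrite ord1 in vk; rewrite mulf_eq0 (negbTE yj) (negbTE vk).
- by split=> // M; rewrite inE => /eqP ->; exact: (codom_f _ (Ordinal m0)).
- exact: ltr01.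
- move=> s [_ /all1 sE]; left; exists [:: 1%:M], (size s); split=> //.
  by exists 0%N.
- exists 1; rewrite p1; split.
  + by split; [exact: e1|move=> y /eig1 ->].
  + rewrite /complexify map_mx1 /char_poly det_mx11 !mxE eqxx mulr1n.
    by have := @mup_XsubCX R[i] 1 1 1; rewrite eqxx expr1.
  + by move=> y /eig1 ->; rewrite eqxx.
- by exists 1; [rewrite p1; exact: e1|exact: modulus1].
- by move=> z; rewrite p1 => /eig1 ->; rewrite modulus1.
Qed.

Lemma zero_family_hull (R : realType) (m n : nat) (A : 'I_m -> 'M[R]_n.+1) H :
  (0 < m)%N -> (forall i, A i = 0) -> convex_body H ->
  convex_hull (\bigcup_i [set A i *m x | x in H]) = scale_set 0 H.
Proof.
move=> m0 A0 HB; have H0 := convex_body0 HB.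
have -> : scale_set 0 H = [set 0].
  apply/seteqP; split=> [_ [x _ <-]|_ ->]; first by rewrite scale0r.
  by exists 0; rewrite ?scale0r.
have -> : \bigcup_i [set A i *m x | x in H] = [set 0].
  apply/seteqP; split=> [_ [i _ [x _ <-]]|_ ->]; first by rewrite A0 mul0mx.
  by exists (Ordinal m0) => //; exists 0; rewrite // mulmx0.
apply: smallest_id; apply/convex_setP => _ _ t _ -> ->.
by rewrite !scaler0 addr0.
Qed.

Lemma identity_family_hull (R : realType) (m n : nat) (H : set 'cV[R]_n.+1) :
  (0 < m)%N -> convex_body H ->
  convex_hull (\bigcup_(_ in [set: 'I_m]) [set 1%:M *m x | x in H]) = scale_set 1 H.
Proof.
move=> m0 HB.
have -> : scale_set 1 H = H.
  by apply/seteqP; split=> [_ [x Hx <-]|x Hx]; [rewrite scale1r|exists x; rewrite ?scale1r].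
have -> : \bigcup_(_ in [set: 'I_m]) [set 1%:M *m x | x in H] = H.
  apply/seteqP; split=> [_ [_ _ [x Hx <-]]|x Hx]; first by rewrite mul1mx.
  by exists (Ordinal m0) => //; exists x; rewrite // mul1mx.
by apply: smallest_id; case: HB.
Qed.

Unset Implicit Arguments.

Theorem corollary2 (R : realType) (d m : nat) (A : 'I_m -> 'M[R]_d)
    (Airr : irreducible_family A)
    (Age0 : forall (i : 'I_m) (j k : 'I_d), 0 <= A i j k)
    (Pi : seq 'M[R]_d)
    (Pi_dom : unique_dominant_product A Pi)
    (Pi_lead : has_unique_simple_leading_eigenvalue (word_prod Pi)) :
  (exists G : set 'cV[R]_d, invariant_body A G /\
     forall H : set 'cV[R]_d, invariant_body A H ->
       exists2 c : R, 0 < c & H = scale_set c G) /\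
  (exists f : 'cV[R]_d -> R, barabanov_norm A f /\
     forall g : 'cV[R]_d -> R, barabanov_norm A g ->
       exists2 c : R, 0 < c & forall x : 'cV[R]_d, g x = c * f x).
Proof.
case: d A Airr Age0 Pi Pi_dom Pi_lead => [|n] A Airr Age0 Pi Pi_dom Pi_lead.
  (* In dimension [0] no nonzero eigenvector exists, so [Pi_lead] is contradictory. *)
  case: Pi_lead => z [[/eigenvalueP[x _ x0] _] _ _].
  by case/negP: x0; apply/eqP/rowP => -[].
case: Pi_dom => /(_ Pi erefl) PiA _ _ [q [/(_ Pi erefl) nuPi [eps [eps01 gap]]]].
have m0 : (0 < m)%N.
  case: PiA; case: (Pi) => [//|M s] _ /(_ M (mem_head _ _))/codomP[i _].
  exact: leq_ltn_trans (ltn_ord i).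
have q0 : 0 <= q by rewrite -nuPi powR_ge0.
have {}gap := dominant_gap q0 eps01 gap.
have rhoPi : spectral_radius (word_prod Pi) = q ^+ size Pi.
  by rewrite -nu_power ?nuPi//; case: PiA.
have [qz|qn0] := eqVneq q 0.
  have szPi : size Pi != 0%N by rewrite size_eq0; apply/eqP; case: PiA.
  have [||Az n0] := dominant_zero Airr Age0 (p := Pi).
  - move=> s hs; have := gap s hs; rewrite qz expr0n size_eq0.
    by have := hs.1 => /eqP/negbTE ->; rewrite mulr0.
  - by rewrite rhoPi qz expr0n (negbTE szPi).
  subst n; have jsr0 := joint_spectral_radius0 Az.
  have [] := @normalized_uniqueness R m 0 (fun _ => 1%:M) 1 [:: 1%:M] 0 ltr01 m0.
    by under eq_fun do rewrite invr1 scale1r; exact: identity_normalized_family.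
  move=> [G [[GB _] Guniq]] [f [fN _ funiq]]; split.
    exists G; split; first by split=> //; rewrite jsr0; exact: zero_family_hull.
    by move=> H [HB _]; apply: Guniq => //; exact: identity_family_hull.
  have bar g : is_norm g -> barabanov_norm A g.
    move=> gN; split=> //; apply/bigmax_extremal => //; rewrite jsr0//.
    by split=> [i x|x]; [|exists (Ordinal m0)]; rewrite Az mul0mx mul0r is_norm0.
  exists f; split; first exact: bar.
  move=> g [gN _]; apply: funiq => //; split=> [i x|x]; last exists (Ordinal m0);
    by rewrite mul1mx mul1r.
have qpos : 0 < q by rewrite lt_def qn0.
have nf := normalized_family_scale Airr Age0 qpos eps01 PiA gap rhoPi Pi_lead.
have jsr := normalized_joint_spectral_radius qpos nf.
have [[G [GB Guniq]] [f [fN fE funiq]]] := normalized_uniqueness qpos m0 nf.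
split.
  exists G; split; first by rewrite /invariant_body jsr.
  by move=> H [HB]; rewrite jsr; exact: Guniq.
exists f; split.
  by split=> //; rewrite jsr; apply/bigmax_extremal.
by move=> g [gN]; rewrite jsr => /bigmax_extremal gE; apply: funiq => //; exact: gE.
Qed.
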